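(* Fix a sequence $k=k(n)$ and a sequence $T=T(n)$ satisfying $T(n)=\omega\big(nk\,(k+\log n)\log n\big)$, i.e. $T(n)/\big(n\,k(n)\,(k(n)+\log n)\log n\big)\to\infty$ as $n\to\infty$. Then, for starting points $x=x_n\in SO(n)$, the sequences of measures $\mathcal{K}_{n,T(n),x_n}$ and $\mathcal{H}_n$ on $SO(n)$ are weakly indistinguishable by degree-$k(n)$ polynomials.
   Context: $SO(n)$ is the group of real orthogonal $n\times n$ matrices of determinant $1$, and $\mathcal{H}_n$ is its Haar probability measure. For $1\le i<j\le n$ and $\theta\in[0,2\pi)$ let $R_{ij}(\theta)=I_n+(\cos\theta-1)(E_{ii}+E_{jj})+\sin\theta\,E_{ij}-\sin\theta\,E_{ji}$, where $E_{ab}$ are the matrix units. Kac's walk on $SO(n)$ is $X_{t+1}=R_{i_tj_t}(\theta_t)X_t$, with $(i_t,j_t)$ chosen uniformly and independently from $\{(i,j):1\le i<j\le n\}$ and $\theta_t$ sampled independently from the uniform distribution on $[0,2\pi)$. $\mathcal{K}_{n,T,x}$ is the law of $X_T$ when $X_0=x$. Let $\mu_n,\nu_n$ be two sequences of probability distributions on sets $\mathcal{S}_n$ and let $f_n:\mathcal{S}_n\to\mathbb{R}$ be a sequence of functions. The sequence $f_n$ weakly distinguishes $\mu_n$ and $\nu_n$ if $\sqrt{\max(\mathrm{Var}_{\mu_n}(f_n),\mathrm{Var}_{\nu_n}(f_n))}=O\big(|\mathbb{E}_{\mu_n}[f_n]-\mathbb{E}_{\nu_n}[f_n]|\big)$ as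 $n\to\infty$. For a monotone sequence $k(n)$, $\mu_n,\nu_n$ are weakly indistinguishable by degree-$k(n)$ polynomials if, for every sequence of real polynomials $f_n$ (here, in the matrix entries) with $\deg(f_n)\le k(n)$, the sequence $f_n$ does not weakly distinguish $\mu_n$ and $\nu_n$.
   Formalization: Weakly distinguishing additionally requires that the difference of expectations is not zero for all large n, since otherwise constant polynomials (0 = O(0)) would weakly distinguish any two sequences and the claim would be false. *)

(* Defs.v *)
From HB Require Import structures.
From mathcomp Require Import all_boot all_order all_algebra.
(* The notations of [mpoly] clash with those of mathcomp-analysis. *)
From mathcomp Require Import -(notations) mpoly.
From mathcomp Require Import all_classical all_reals all_analysis.
From mathcomp Require Import measurable_realfun ring lra.

Set Implicit Arguments.
Unset Strict Implicit.
Unset Printing Implicit Defensive.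

Import Order.TTheory GRing.Theory Num.Theory.
Import numFieldNormedType.Exports.

Local Open Scope classical_set_scope.
Local Open Scope ring_scope.

Section special_orthogonal_group.
Context (R : realType) (n : nat).

Definition SO_set : set 'M[R]_n := [set A | A *m A^T = 1%:M /\ \det A = 1].

Definition SO : Type := set_type SO_set.

Definition SO_mx (x : SO) : 'M[R]_n := set_val x.

Lemma SO_mxP (x : SO) : SO_set (SO_mx x).
Proof. exact: set_valP. Qed.

Definition mkSO (A : 'M[R]_n) (hA : SO_set A) : SO := exist _ A (mem_set hA).

Lemma SO_set1 : SO_set 1%:M.
Proof. by split; rewrite ?trmx1 ?mulmx1 ?det1. Qed.

Lemma SO_setM (A B : 'M[R]_n) : SO_set A -> SO_set B -> SO_set (A *m B).
Proof.
move=> [AA dA] [BB dB]; split; last by rewrite det_mulmx dA dB mulr1.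
by rewrite trmx_mul mulmxA -(mulmxA A) BB mulmx1.
Qed.

Definition SO_mul (x y : SO) : SO := mkSO (SO_setM (SO_mxP x) (SO_mxP y)).

HB.instance Definition _ := Choice.copy SO (set_type SO_set).
HB.instance Definition _ := Topological.copy SO (set_type SO_set).
HB.instance Definition _ := isPointed.Build SO (mkSO SO_set1).
HB.instance Definition _ :=
  Measurable.copy SO (g_sigma_algebraType (open : set (set SO))).

End special_orthogonal_group.

Section SO_measurability.
Context (R : realType) (n : nat).

Lemma measurable_SO_coord (i j : 'I_n) :
  measurable_fun [set: SO R n] (fun x : SO R n => SO_mx x i j : R).
Proof.
apply: (measurability _ (RGenOpens.measurableE R)) => _ [_ [a [b ->]] <-].
rewrite setTI; apply: sub_sigma_algebra.
exists ((fun M : 'M[R]_n => M i j) @^-1` `]a, b[%classic) => //.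
by apply: open_comp; [move=> M _; exact: coord_continuous|exact: interval_open].
Qed.

Let box (q : 'M[rat]_n * nat) : set 'M[R]_n :=
  [set M | forall i j, `|M i j - ratr (q.1 i j)| < q.2.+1%:R^-1].

Let open_box (U : set 'M[R]_n) : open U ->
  U = \bigcup_(q in [set q | box q `<=` U]) box q.
Proof.
move=> oU; apply/seteqP; split => [M UM|M [q /=]]; last exact.
have /nbhs_ballP[e /= e0 eU] : nbhs M U by exact: open_nbhs_nbhs.
have e20 : 0 < e / 2 by rewrite divr_gt0.
have [k ke] : exists k : nat, k.+1%:R^-1 < e / 2.
  have [k _ /(_ k (leqnn k)) /=] := near_infty_natSinv_lt (PosNum e20).
  by exists k.
have k0 : 0 < k.+1%:R^-1 :> R by rewrite invr_gt0.
have /all_sig2[q _ qM] (ij : 'I_n * 'I_n) :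
    {q : rat | True & `|M ij.1 ij.2 - ratr q| < k.+1%:R^-1}.
  have /rat_in_itvoo/cid[q] :
      M ij.1 ij.2 - k.+1%:R^-1 < M ij.1 ij.2 + k.+1%:R^-1 by
      rewrite (lt_trans (y := M ij.1 ij.2)) ?ltrBlDr ?ltrDl.
  by rewrite in_itv/= => qM; exists q => //; rewrite distrC ltr_distl.
pose Q : 'M[rat]_n := \matrix_(i, j) q (i, j).
exists (Q, k); last by move=> i j; rewrite /= mxE; exact: (qM (i, j)).
move=> N QN; apply: eU; split => // i j.
have := QN i j; rewrite /= mxE => QNij; have := qM (i, j) => /= QMij.
rewrite /ball /= (_ : M i j - N i j =
  (M i j - ratr (q (i, j))) - (N i j - ratr (q (i, j)))); last by ring.
rewrite (le_lt_trans (ler_normB _ _))// (splitr e) ltrD//.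
  exact: lt_trans QMij ke.
exact: lt_trans QNij ke.
Qed.

Lemma measurable_fun_SO d (T : measurableType d) (f : T -> SO R n) :
  (forall i j, measurable_fun [set: T] (fun t => SO_mx (f t) i j : R)) ->
  measurable_fun [set: T] f.
Proof.
move=> mf; apply: (measurability (open : set (set (SO R n)))) => //.
move=> _ [_ [U oU <-] <-]; rewrite setTI.
rewrite -comp_preimage (open_box oU) preimage_bigcup.
rewrite bigcup_mkcond; apply: countable_bigcupT_measurable => [|q].
  exact: countableP.
case: ifPn => // _.
rewrite (_ : _ @^-1` _ = \bigcap_(ij : 'I_n * 'I_n)
   [set t | `|SO_mx (f t) ij.1 ij.2 - ratr (q.1 ij.1 ij.2)| < q.2.+1%:R^-1]).
  apply: fin_bigcap_measurable => // ij _.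
  have -> : [set t | `|SO_mx (f t) ij.1 ij.2 - ratr (q.1 ij.1 ij.2)| <
      q.2.+1%:R^-1] = [set: T] `&` (fun t =>
      SO_mx (f t) ij.1 ij.2 - ratr (q.1 ij.1 ij.2)) @^-1`
      [set` `]- q.2.+1%:R^-1, q.2.+1%:R^-1[ ].
    by rewrite setTI; apply/seteqP; split => t /=; rewrite in_itv/= ltr_norml.
  by apply: measurable_funB => //; exact: measurable_cst.
by apply/seteqP; split => t /= qt ij => [_|j]; [exact: qt|exact: (qt (ij, j))].
Qed.

End SO_measurability.

Section rotation.
Context (R : realType) (n : nat).

Definition rot_mx (i j : 'I_n) (theta : R) : 'M[R]_n :=
  1%:M + (cos theta - 1) *: (delta_mx i i + delta_mx j j)
       + sin theta *: delta_mx i j - sin theta *: delta_mx j i.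

Lemma rot_mx0 i j : rot_mx i j 0 = 1%:M.
Proof. by rewrite /rot_mx cos0 sin0 subrr !scale0r !addr0 subr0. Qed.

Lemma rot_mxD i j a b : i != j ->
  rot_mx i j a *m rot_mx i j b = rot_mx i j (a + b).
Proof.
move=> ij; have ji : j != i by rewrite eq_sym.
rewrite /rot_mx cosD sinD.
rewrite !(mulmxDl, mulmxDr, mulNmx, mulmxN, mul1mx, mulmx1).
rewrite -!(scalemxAl, scalemxAr) !(mulmxDl, mulmxDr, mulNmx, mulmxN).
rewrite !mul_delta_mx_cond !eqxx (negbTE ij) (negbTE ji) !mulr0n !mulr1n.
by apply/matrixP => u v; rewrite !mxE; ring.
Qed.

Lemma tr_rot_mx i j a : (rot_mx i j a)^T = rot_mx i j (- a).
Proof.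
rewrite /rot_mx cosN sinN; apply/matrixP => u v; rewrite !mxE.
rewrite (eq_sym v u) (andbC (v == i) (u == i)) (andbC (v == j) (u == j)).
by rewrite (andbC (v == i)) (andbC (v == j)); ring.
Qed.

Lemma SO_set_rot_mx i j a : i != j -> SO_set (rot_mx i j a).
Proof.
move=> ij.
have orth b : rot_mx i j b *m (rot_mx i j b)^T = 1%:M.
  by rewrite tr_rot_mx rot_mxD// subrr rot_mx0.
split => //; rewrite (splitr a) -rot_mxD// det_mulmx.
by rewrite -[X in _ * X]det_tr -det_mulmx orth det1.
Qed.

Definition rot_index : finType := {p : 'I_n * 'I_n | (p.1 < p.2)%N}.

Lemma rot_index_neq (p : rot_index) : (val p).1 != (val p).2.
Proof. by case: p => -[i j] /= ij; rewrite neq_ltn ij. Qed.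

Definition rot (p : rot_index) (theta : R) : SO R n :=
  mkSO (SO_set_rot_mx theta (rot_index_neq p)).

Definition rot_act (p : rot_index) (xt : SO R n * measurableTypeR R) : SO R n :=
  SO_mul (rot p xt.2) xt.1.

Lemma measurable_rot_act p :
  measurable_fun [set: SO R n * measurableTypeR R] (rot_act p).
Proof.
apply: measurable_fun_SO => i j.
have mcos : measurable_fun [set: SO R n * measurableTypeR R]
    (fun xt => cos xt.2 : R).
  apply: measurableT_comp => //.
  by apply: continuous_measurable_fun; exact: continuous_cos.
have msin : measurable_fun [set: SO R n * measurableTypeR R]
    (fun xt => sin xt.2 : R).
  apply: measurableT_comp => //.
  by apply: continuous_measurable_fun; exact: continuous_sin.
under eq_fun do rewrite /SO_mx /= mxE.
apply: measurable_sum => k; apply: measurable_funM.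
  under eq_fun do rewrite /rot_mx !mxE.
  apply: measurable_funB; last by apply: measurable_funM => //.
  apply: measurable_funD; last by apply: measurable_funM => //.
  apply: measurable_funD => //; apply: measurable_funM => //.
  exact: measurable_funB.
by apply: (measurableT_comp (measurable_SO_coord k j)); exact: measurable_fst.
Qed.

HB.instance Definition _ p :=
  isMeasurableFun.Build _ _ _ _ (rot_act p) (measurable_rot_act p).

End rotation.

Section uniform_mixture.
Context d (T : measurableType d) (R : realType) (I : finType).
Variables (m0 : probability T R) (m : I -> probability T R).

(* [m0] is only a default for empty [I]. *)
Definition uniform_mixture (A : set T) : \bar R :=
  if #|I| == 0%N then m0 A else ((#|I|%:R^-1)%:E * \sum_(i : I) m i A)%E.

Let weight_ge0 : 0 <= #|I|%:R^-1 :> R. Proof. by rewrite invr_ge0. Qed.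

Let uniform_mixtureE : uniform_mixture =
  if pickP (@predT I) is Pick i0 _ then
    mscale (NngNum weight_ge0) (msum (fun k => m (nth i0 (enum I) k)) #|I|)
  else m0.
Proof.
apply/funext => A; rewrite /uniform_mixture; case: pickP => [i0 _|I0].
  rewrite gtn_eqF; last by apply/card_gt0P; exists i0.
  rewrite /mscale /msum /=; congr (_ * _)%E.
  by rewrite -big_enum /= (big_nth i0) -cardE big_mkord.
by rewrite (eq_card0 I0) eqxx.
Qed.

Let uniform_mixture0 : uniform_mixture set0 = 0%E.
Proof. by rewrite uniform_mixtureE; case: pickP => *; rewrite measure0. Qed.

Let uniform_mixture_ge0 A : (0 <= uniform_mixture A)%E.
Proof. by rewrite uniform_mixtureE; case: pickP => *; rewrite measure_ge0. Qed.

Let uniform_mixture_sigma_additive : semi_sigma_additive uniform_mixture.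
Proof.
rewrite uniform_mixtureE; case: pickP => *;
  exact: measure_semi_sigma_additive.
Qed.

HB.instance Definition _ := isMeasure.Build _ _ _ uniform_mixture
  uniform_mixture0 uniform_mixture_ge0 uniform_mixture_sigma_additive.

Let uniform_mixtureT : uniform_mixture [set: T] = 1%E.
Proof.
rewrite /uniform_mixture; case: eqVneq => [_|I0]; first exact: probability_setT.
under eq_bigr do rewrite probability_setT.
rewrite sumEFin big_const iter_addr_0 -EFinM mulVf// pnatr_eq0//.
Qed.

HB.instance Definition _ :=
  Measure_isProbability.Build _ _ _ uniform_mixture uniform_mixtureT.

End uniform_mixture.

Section kac_walk.
Context (R : realType) (n : nat).

Lemma two_pi_gt0 : 0 < pi *+ 2 :> R.
Proof. by rewrite mulrn_wgt0// pi_gt0. Qed.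

(* [uniform_prob] is carried by the closed interval; its endpoint is null, so this
   is also the uniform distribution on [0, 2 pi). *)
Definition uniform_angle : probability (measurableTypeR R) R :=
  uniform_prob two_pi_gt0.

(* If X has law mu, [kac_step mu] is the law of R_ij(theta) X with X, (i, j) and
   theta independent. For n <= 1 there is no pair i < j and SO(n) is a point. *)
Definition kac_step (mu : probability (SO R n) R) : probability (SO R n) R :=
  uniform_mixture mu
    (fun p : rot_index n => distribution (mu \x uniform_angle)%E (rot_act p)).

Fixpoint kac_law (T : nat) (x : SO R n) : probability (SO R n) R :=
  if T is T'.+1 then kac_step (kac_law T' x) else \d_x.

Definition is_haar (mu : probability (SO R n) R) : Prop :=
  forall (g : SO R n) (A : set (SO R n)), measurable A ->
    mu (SO_mul g @` A) = mu A.

End kac_walk.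

(* The second conjunct excludes sequences for which the O-bound reads 0 = O(0) for
   all large n; without it, constant f_n would distinguish any two sequences. *)
Definition weakly_distinguishes (R : realType) (d : nat -> measure_display)
    (S : forall n, measurableType (d n)) (mu nu : forall n, probability (S n) R)
    (f : forall n, S n -> R) : Prop :=
  let gap n : R^o := `|fine 'E_(mu n)[f n] - fine 'E_(nu n)[f n]| in
  let sd n : R^o := Num.sqrt
    (Num.max (fine (variance (mu n) (f n))) (fine (variance (nu n) (f n)))) in
  sd =O_\oo gap /\ ~ (\forall n \near \oo, gap n = 0).

Definition poly_eval (R : realType) (n : nat) (p : mpoly.mpoly (n * n) R)
    (x : SO R n) : R :=
  mpoly.meval (fun k => mxvec (SO_mx x) ord0 k) p.

(* [msize p] is deg p + 1, and 0 for p = 0. *)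
Definition weakly_indistinguishable_by_degree (R : realType) (k : nat -> nat)
    (mu nu : forall n, probability (SO R n) R) : Prop :=
  forall f : forall n, mpoly.mpoly (n * n) R,
    (forall n, (mpoly.msize (f n) <= (k n).+1)%N) ->
    ~ weakly_distinguishes mu nu (fun n => poly_eval (f n)).

(* Main.v *)
(** Polynomials of degree at most k in the entries of x are the functions
    <c, rho(x) e> for a representation rho of SO(n), of dimension
    D = (n^2 + 1)^k, all of whose weights are at most k. One step of the walk acts
    on c as the average M over i < j of the orthogonal projections on the kernels
    of the generators L_ij. Since L_ij, L_ib and L_jb span a copy of so(3), the
    weights of L_ij satisfy |m| <= L_ib^T L_ib + L_jb^T L_jb; summing over b and
    using |m| >= m^2 / k shows that the Casimir operator dominates
    2 (n - 1) / k times L_ij^T L_ij, which makes M a contraction by the factor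
    1 - 1 / (n k) for the Casimir form. The kernel of that form consists of the
    c giving constant functions (Givens rotations generate SO(n)), so the Haar
    variance of <M^t c, rho(x) e> decays at the same rate, and log-convexity in t
    removes the constant. Finally a translation invariant space of functions of
    dimension D satisfies sup |f|^2 <= D E|f|^2, so the squared gap between the
    two expectations is at most D (1 - 1 / (n k))^T Var f, where the prefactor is
    at most 1 / n as soon as T >= 4 n k (k + log n) log n. *)

From HB Require Import structures.
Require Import Defs.
From mathcomp Require Import all_boot all_order all_algebra.
From mathcomp Require Import -(notations) mpoly.
From mathcomp Require Import all_classical all_reals all_analysis.
From mathcomp Require Import measurable_realfun mxtens zify ring lra.

Set Implicit Arguments.
Unset Strict Implicit.
Unset Printing Implicit Defensive.

Import Order.TTheory GRing.Theory Num.Theory.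
Import numFieldNormedType.Exports.

Local Open Scope classical_set_scope.
Local Open Scope ring_scope.

(** * Linear algebra *)

Section log_convex.
Context {R : realType}.

(** Log-convexity makes the ratios [a t.+1 / a t] nondecreasing, so a first ratio [r > q] would give
    [a t >= r ^+ t * a 0], which outgrows [C * q ^+ t] whatever [C] is. *)
Lemma log_convex_ratio (a : nat -> R) (C q : R) : 0 < q ->
  (forall t, 0 <= a t) -> (forall t, a t.+1 ^+ 2 <= a t * a t.+2) ->
  (forall t, a t <= C * q ^+ t) -> a 1%N <= q * a 0%N.
Proof.
move=> q0 a_ge0 a_cvx a_le; rewrite leNgt; apply/negP => qa.
have a00 : 0 < a 0%N.
  rewrite lt_neqAle a_ge0 andbT eq_sym; apply/eqP => a00.
  have := a_cvx 0%N; rewrite a00 mul0r => /(le_trans (sqr_ge0 _)).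
  move: qa (a_cvx 0%N); rewrite a00 mulr0 mul0r => a1 a1'.
  by have := lt_le_trans (exprn_gt0 2 a1) a1'; rewrite ltxx.
pose r := a 1%N / a 0%N.
have qr : q < r by rewrite ltr_pdivlMr.
have r0 : 0 < r by exact: lt_trans qr.
have step t : 0 < a t /\ r * a t <= a t.+1.
  elim: t => [|t [at0 IH]]; first by rewrite /r divfK ?gt_eqF.
  have at1 : 0 < a t.+1 by apply: lt_le_trans IH; rewrite mulr_gt0.
  split => //; rewrite -(ler_pM2l at0); apply: le_trans (a_cvx t).
  by rewrite mulrCA mulrA expr2 ler_wpM2r// ltW.
have grow t : r ^+ t * a 0%N <= a t.
  elim: t => [|t IH]; first by rewrite expr0 mul1r.
  by rewrite exprS -mulrA; apply: le_trans (step t).2; rewrite ler_wpM2l// ltW.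
(* Bernoulli's inequality makes [(r / q) ^+ t] unbounded, while the two growth estimates bound it by
   [C / a 0]. *)
pose e := r / q - 1.
have e0 : 0 < e by rewrite subr_gt0 ltr_pdivlMr// mul1r.
have bern t : 1 + e *+ t <= (r / q) ^+ t.
  have -> : r / q = 1 + e by rewrite /e addrC subrK.
  elim: t => [|t IH]; first by rewrite mulr0n addr0 expr0.
  rewrite exprS mulrDl mul1r mulrSr addrA lerD// -[leLHS]mulr1 ler_pM2l//.
  by apply: le_trans IH; rewrite lerDl mulrn_wge0// ltW.
have bnd t : e *+ t <= C / a 0%N.
  apply: le_trans (_ : (r / q) ^+ t <= _); first by apply: le_trans (bern t); rewrite lerDr.
  rewrite ler_pdivlMr// expr_div_n mulrAC ler_pdivrMr ?exprn_gt0//.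
  exact: le_trans (grow t) (a_le t).
have [t] : exists t : nat, C / a 0%N / e < t%:R.
  by exists (Num.truncn (C / a 0%N / e)).+1; exact: truncnS_gt.
by rewrite ltr_pdivrMr// mulr_natl ltNge bnd.
Qed.

End log_convex.

(** * The Euclidean form, positive semidefinite matrices and weight bounds *)

Section euclid.
Context {R : realType}.

Definition dotv {D : nat} (u v : 'cV[R]_D) : R := \sum_i u i 0 * v i 0.

Lemma dotvC D (u v : 'cV[R]_D) : dotv u v = dotv v u.
Proof. by apply: eq_bigr => i _; rewrite mulrC. Qed.

Lemma dotvDl D (u v w : 'cV[R]_D) : dotv (u + v) w = dotv u w + dotv v w.
Proof. by rewrite -big_split; apply: eq_bigr => i _; rewrite mxE mulrDl. Qed.

Lemma dotvDr D (u v w : 'cV[R]_D) : dotv u (v + w) = dotv u v + dotv u w.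
Proof. by rewrite dotvC dotvDl !(dotvC u). Qed.

Lemma dotvZl D a (u v : 'cV[R]_D) : dotv (a *: u) v = a * dotv u v.
Proof. by rewrite mulr_sumr; apply: eq_bigr => i _; rewrite mxE mulrA. Qed.

Lemma dotvZr D a (u v : 'cV[R]_D) : dotv u (a *: v) = a * dotv u v.
Proof. by rewrite dotvC dotvZl dotvC. Qed.

Lemma dotvNl D (u v : 'cV[R]_D) : dotv (- u) v = - dotv u v.
Proof. by rewrite -scaleN1r dotvZl mulN1r. Qed.

Lemma dotvNr D (u v : 'cV[R]_D) : dotv u (- v) = - dotv u v.
Proof. by rewrite dotvC dotvNl dotvC. Qed.

Lemma dotvBr D (u v w : 'cV[R]_D) : dotv u (v - w) = dotv u v - dotv u w.
Proof. by rewrite dotvDr dotvNr. Qed.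

Lemma dotv0l D (u : 'cV[R]_D) : dotv 0 u = 0.
Proof. by rewrite -(scale0r 0) dotvZl mul0r. Qed.

Lemma dotv0r D (u : 'cV[R]_D) : dotv u 0 = 0.
Proof. by rewrite dotvC dotv0l. Qed.

Lemma dotv_suml D (I : Type) (r : seq I) (P : pred I) (F : I -> 'cV[R]_D) v :
  dotv (\sum_(i <- r | P i) F i) v = \sum_(i <- r | P i) dotv (F i) v.
Proof.
elim/big_rec2: _ => [|i x y _ <-]; first exact: dotv0l.
exact: dotvDl.
Qed.

Lemma dotv_sumr D (I : Type) (r : seq I) (P : pred I) (F : I -> 'cV[R]_D) v :
  dotv v (\sum_(i <- r | P i) F i) = \sum_(i <- r | P i) dotv v (F i).
Proof. by rewrite dotvC dotv_suml; apply: eq_bigr => i _; exact: dotvC. Qed.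

Lemma dotv_mx D (u v : 'cV[R]_D) : dotv u v = (u^T *m v) 0 0.
Proof. by rewrite mxE; apply: eq_bigr => i _; rewrite mxE. Qed.

Lemma dotv_mulmxl m D (A : 'M[R]_(m, D)) u v :
  dotv (A *m u) v = dotv u (A^T *m v).
Proof. by rewrite !dotv_mx trmx_mul -mulmxA. Qed.

Lemma dotv_mulmxr m D (A : 'M[R]_(m, D)) u v :
  dotv u (A *m v) = dotv (A^T *m u) v.
Proof. by rewrite dotv_mulmxl trmxK. Qed.

Lemma dotv_ge0 D (u : 'cV[R]_D) : 0 <= dotv u u.
Proof. by apply: sumr_ge0 => i _; rewrite -expr2 sqr_ge0. Qed.

Lemma dotv_eq0 D (u : 'cV[R]_D) : (dotv u u == 0) = (u == 0).
Proof.
apply/eqP/eqP => [|->]; last exact: dotv0l.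
move/psumr_eq0P => u0; apply/matrixP => i j; rewrite ord1 mxE.
apply/eqP; rewrite -sqrf_eq0 expr2; apply/eqP; apply: u0 => // k _.
by rewrite -expr2 sqr_ge0.
Qed.

Definition psd D (A : 'M[R]_D) : Prop :=
  A^T = A /\ forall u, 0 <= dotv u (A *m u).

Lemma psd_sym D (A : 'M[R]_D) u v : A^T = A ->
  dotv u (A *m v) = dotv v (A *m u).
Proof. by move=> sA; rewrite dotv_mulmxr sA dotvC. Qed.

Lemma psd_gram m D (A : 'M[R]_(m, D)) : psd (A^T *m A).
Proof.
split=> [|u]; first by rewrite trmx_mul trmxK.
by rewrite -mulmxA -dotv_mulmxl dotv_ge0.
Qed.

Lemma psdD D (A B : 'M[R]_D) : psd A -> psd B -> psd (A + B).
Proof.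
move=> [sA pA] [sB pB]; split=> [|u]; first by rewrite linearD/= sA sB.
by rewrite mulmxDl dotvDr addr_ge0.
Qed.

Lemma psd_sum D (I : finType) (F : I -> 'M[R]_D) :
  (forall i, psd (F i)) -> psd (\sum_i F i).
Proof.
move=> pF; apply: big_ind => // [|A B]; last exact: psdD.
by split=> [|u]; [rewrite trmx0|rewrite mul0mx dotv0r].
Qed.

Lemma quad_ge0 D (A : 'M[R]_D) (u v : 'cV[R]_D) (t : R) : A^T = A ->
  dotv (u + t *: v) (A *m (u + t *: v)) =
  dotv u (A *m u) + dotv u (A *m v) * t *+ 2 + dotv v (A *m v) * t ^+ 2.
Proof.
move=> sA; rewrite mulmxDr -scalemxAr !(dotvDl, dotvDr, dotvZl, dotvZr).
by rewrite (psd_sym v u sA); ring.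
Qed.

Lemma psd_cauchy_schwarz D (A : 'M[R]_D) u v : psd A ->
  dotv u (A *m v) ^+ 2 <= dotv u (A *m u) * dotv v (A *m v).
Proof.
move=> [sA pA]; set a := dotv u (A *m u); set b := dotv u _; set c := dotv v _.
have h t : 0 <= a + b * t *+ 2 + c * t ^+ 2 by rewrite -quad_ge0.
have c0 : 0 <= c by exact: pA.
move: c0; rewrite le_eqVlt => /predU1P[c0|c0].
  rewrite -c0 mulr0; have [-> //|b0] := eqVneq b 0; first by rewrite expr0n.
  (* With [c = 0] the nonnegative polynomial is affine, and at this argument it would take the value
     -1. *)
  have := h (- (a + 1) / (b *+ 2)); rewrite -c0 mul0r addr0.
  have -> : b * (- (a + 1) / (b *+ 2)) *+ 2 = - (a + 1) by field.
  lra.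
(* The minimiser of the quadratic polynomial. *)
have := h (- b / c).
have -> : a + b * (- b / c) *+ 2 + c * (- b / c) ^+ 2 = (a * c - b ^+ 2) / c.
  by field; rewrite gt_eqF.
by rewrite pmulr_lge0 ?invr_gt0// subr_ge0.
Qed.

(** Cauchy-Schwarz for the form [A] between [v] and [Z (Z v)]: moving one [Z] to the other side
    costs at most a sign, which the square removes. *)
Lemma psd_orbit_log_convex D (A Z : 'M[R]_D) u : psd A -> A *m Z = Z *m A ->
  Z^T = Z \/ Z^T = - Z ->
  let a t := let v := iter t (mulmx Z) u in dotv v (A *m v) in
  forall t, a t.+1 ^+ 2 <= a t * a t.+2.
Proof.
move=> pA cAZ sZ /= t; set v := iter t _ _.
apply: le_trans (psd_cauchy_schwarz v (Z *m (Z *m v)) pA).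
have -> : dotv v (A *m (Z *m (Z *m v))) = dotv (Z^T *m v) (A *m (Z *m v)).
  by rewrite -dotv_mulmxr (mulmxA A) cAZ -mulmxA.
by case: sZ => ->; rewrite ?mulNmx ?dotvNl ?sqrrN.
Qed.

Lemma dotv_bound D (u v : 'cV[R]_D) (a b : R) :
  (forall i, `|u i 0| <= a) -> (forall i, `|v i 0| <= b) ->
  dotv u v <= D%:R * (a * b).
Proof.
move=> ua vb; rewrite /dotv (le_trans (ler_norm _))//.
apply: le_trans (ler_norm_sum _ _ _) _.
have -> : D%:R * (a * b) = \sum_(i < D) a * b.
  by rewrite sumr_const card_ord mulr_natl.
apply: ler_sum => i _.
by rewrite normrM ler_pM.
Qed.

(** A bound on the operator norm for the sup norm. It dominates the eigenvalues, and it behaves well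
    under Kronecker products. *)
Definition rowsum_le m D (k : R) (A : 'M[R]_(m, D)) : Prop :=
  forall i, \sum_j `|A i j| <= k.

Lemma rowsum_le_mul m D (k a : R) (A : 'M[R]_(m, D)) (u : 'cV_D) :
  rowsum_le k A -> 0 <= a -> (forall i, `|u i 0| <= a) ->
  forall i, `|(A *m u) i 0| <= k * a.
Proof.
move=> kA a0 ua i; rewrite mxE (le_trans (ler_norm_sum _ _ _))//.
apply: le_trans (_ : \sum_j `|A i j| * a <= _).
  by apply: ler_sum => j _; rewrite normrM ler_wpM2l.
by rewrite -mulr_suml ler_wpM2r.
Qed.

Lemma rowsum_le_iter D (k : R) (Z : 'M[R]_D) (u : 'cV[R]_D) a :
  0 <= k -> rowsum_le k Z -> 0 <= a -> (forall i, `|u i 0| <= a) ->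
  forall t i, `|(iter t (mulmx Z) u) i 0| <= k ^+ t * a.
Proof.
move=> k0 kZ a0 ua; elim=> [|t IH] i; first by rewrite expr0 mul1r.
by rewrite iterS exprS -mulrA; apply: rowsum_le_mul => //; rewrite mulr_ge0 ?exprn_ge0.
Qed.

Lemma cV_bounded D (u : 'cV[R]_D) : exists2 a, 0 <= a & forall i, `|u i 0| <= a.
Proof.
exists (\sum_i `|u i 0|) => [|i]; first by rewrite sumr_ge0.
by rewrite (bigD1 i)//= lerDl sumr_ge0.
Qed.

Lemma rowsum_bounded m D (A : 'M[R]_(m, D)) : exists a, rowsum_le a A.
Proof.
exists (\sum_i \sum_j `|A i j|) => i.
by rewrite [leRHS](bigD1 i)//= lerDl sumr_ge0// => j _; rewrite sumr_ge0.
Qed.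

(* A Bernstein inequality: log-convexity turns the growth bound on the powers of
   [Z] into an estimate with the same constant and no prefactor. *)
Lemma psd_bernstein D (A Z : 'M[R]_D) (k : R) u : psd A -> A *m Z = Z *m A ->
  Z^T = - Z -> 0 < k -> rowsum_le k Z ->
  dotv (Z *m u) (A *m (Z *m u)) <= k ^+ 2 * dotv u (A *m u).
Proof.
move=> pA cAZ sZ k0 kZ.
have [a a0 ua] := cV_bounded u; have [b Ab] := rowsum_bounded A.
apply: (@log_convex_ratio _
  (fun t => let v := iter t (mulmx Z) u in dotv v (A *m v))
  (D%:R * (a * (b * a)))).
- by rewrite exprn_gt0.
- by move=> t; exact: pA.2.
- by apply: psd_orbit_log_convex => //; right.
(* Crude growth: the entries of the iterate are at most [k ^+ t * a], so the form is at most a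
   constant times [(k ^+ 2) ^+ t]. *)
- move=> t; have ut := rowsum_le_iter (ltW k0) kZ a0 ua t.
  have kt0 : 0 <= k ^+ t * a by rewrite mulr_ge0// exprn_ge0// ltW.
  apply: le_trans (dotv_bound ut (rowsum_le_mul Ab kt0 ut)) _.
  by rewrite exprAC [X in _ <= X * _]mulrA expr2 le_eqVlt; apply/orP; left; apply/eqP; ring.
Qed.

(* With [X], [Y], [Z] spanning a copy of so(3), a weight [m] of [Z] satisfies
   |m| <= X^T X + Y^T Y; since |m| <= k this dominates m^2 / k. *)
Lemma so3_weight_bound D (X Y Z : 'M[R]_D) (k : R) u :
  X^T = - X -> Y^T = - Y -> Z^T = - Z ->
  X *m Y - Y *m X = - Z -> Z *m X - X *m Z = - Y -> Z *m Y - Y *m Z = X ->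
  0 < k -> rowsum_le k Z ->
  dotv (Z *m u) (Z *m u) <= k * (dotv (X *m u) (X *m u) + dotv (Y *m u) (Y *m u)).
Proof.
move=> sX sY sZ cXY cZX cZY k0 kZ.
pose A := X^T *m X + Y^T *m Y.
have pA : psd A by apply: psdD; exact: psd_gram.
have AE v : dotv v (A *m v) = dotv (X *m v) (X *m v) + dotv (Y *m v) (Y *m v).
  by rewrite mulmxDl dotvDr -!mulmxA -!dotv_mulmxl.
(* Bracketing with [Z] rotates the plane of [X] and [Y] infinitesimally, hence preserves the sum of
   their squares. *)
have cAZ : A *m Z = Z *m A.
  apply/eqP; rewrite -subr_eq0; apply/eqP.
  have ZX : Z *m X = X *m Z - Y by rewrite -cZX addrC subrK.
  have ZY : Z *m Y = Y *m Z + X by rewrite -cZY addrC subrK.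
  rewrite /A sX sY !mulNmx !mulmxDl mulmxDr !mulNmx !mulmxN !mulmxA ZX ZY.
  rewrite !mulmxBl !mulmxDl -!mulmxA ZX ZY mulmxBr mulmxDr !mulmxA.
  by apply/matrixP => i j; rewrite !mxE; ring.
have bern := psd_bernstein u pA cAZ sZ k0 kZ.
(* With [w = Z u / k], this is nonnegativity of [|X u + Y w|^2 + |Y u - X w|^2], the real form of
   the squared norm of a ladder operator. The bracket of [X] and [Y] turns the cross terms into
   [|Z u|^2]. *)
have cross : 2 * dotv (Z *m u) (Z *m u) / k <=
    dotv u (A *m u) + dotv (Z *m u) (A *m (Z *m u)) / k ^+ 2.
  set v := Z *m u; rewrite !AE.
  have Zuv : dotv v v = dotv (Y *m u) (X *m v) - dotv (X *m u) (Y *m v).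
    rewrite !dotv_mulmxl sX sY !mulNmx !dotvNr !mulmxA.
    by rewrite opprK addrC -dotvBr -mulmxBl -mulmxBl cXY sZ.
  set w := k^-1 *: v.
  have -> : 2 * dotv v v / k = 2 * (dotv (Y *m u) (X *m w) - dotv (X *m u) (Y *m w)).
    by rewrite -!scalemxAr !dotvZr -mulrBr -Zuv; ring.
  have -> : (dotv (X *m v) (X *m v) + dotv (Y *m v) (Y *m v)) / k ^+ 2 =
      dotv (X *m w) (X *m w) + dotv (Y *m w) (Y *m w).
    by rewrite -!scalemxAr !dotvZr !dotvZl; field; rewrite gt_eqF.
  have h1 := dotv_ge0 (X *m u + Y *m w); have h2 := dotv_ge0 (Y *m u - X *m w).
  rewrite !(dotvDl, dotvDr, dotvNl, dotvNr) in h1 h2.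
  rewrite (dotvC (Y *m w)) in h1; rewrite (dotvC (X *m w)) in h2.
  lra.
have : dotv (Z *m u) (A *m (Z *m u)) / k ^+ 2 <= dotv u (A *m u).
  by rewrite ler_pdivrMr ?exprn_gt0// mulrC.
rewrite -AE => h; have {h cross} : 2 * dotv (Z *m u) (Z *m u) / k <= 2 * dotv u (A *m u).
  by lra.
rewrite ler_pdivrMr// => h; nra.
Qed.

(** [G] may be singular; adding [e] makes the form definite, hence invertible. *)
Lemma psd_regularized_inverse D (G : 'M[R]_D) (e : R) : psd G -> 0 < e ->
  exists B : 'M[R]_D, [/\ psd B, (G + e%:M) *m B = 1%:M,
    B *m (G + e%:M) = 1%:M & \tr (B *m G) <= D%:R].
Proof.
move=> [sG pG] e0; pose A := G + e%:M.
have sA : A^T = A by rewrite linearD/= sG tr_scalar_mx.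
have AE u : dotv u (A *m u) = dotv u (G *m u) + e * dotv u u.
  by rewrite mulmxDl mul_scalar_mx dotvDr dotvZr.
have uA : A \in unitmx.
  rewrite -row_free_unit -kermx_eq0; apply/eqP/row_matrixP => i.
  apply/eqP; rewrite row0 -trmx_eq0 -dotv_eq0 eq_le dotv_ge0 andbT.
  set u := (row i _)^T.
  have uA0 : A *m u = 0.
    by apply: trmx_inj; rewrite trmx_mul trmxK sA trmx0 -row_mul mulmx_ker row0.
  have := AE u; rewrite uA0 dotv0r => /esym; have := pG u.
  by move=> h1 h2; rewrite -(pmulr_rle0 _ e0); lra.
have pB : psd (invmx A).
  split=> [|u]; first by rewrite trmx_inv sA.
  by rewrite -{1}(mulKVmx uA u) dotvC AE addr_ge0// mulr_ge0 ?dotv_ge0 ?ltW.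
exists (invmx A); split => //; [exact: mulmxV|exact: mulVmx|].
(* Here [B G = 1 - e B], and [B] has nonnegative trace because its diagonal entries are values of
   its form. *)
have -> : G = A - e%:M by rewrite addrK.
rewrite mulmxBr mulVmx// linearB/= mxtrace1 mul_mx_scalar linearZ/= lerBlDr lerDl.
apply: mulr_ge0; [exact: ltW|apply: sumr_ge0 => i _]; have := pB.2 (delta_mx i 0).
rewrite /dotv (bigD1 i)//= big1 ?addr0 => [|j ji]; last by rewrite mxE (negbTE ji) mul0r.
rewrite !mxE !eqxx mul1r (bigD1 i)//= big1 ?addr0 => [|j ji]; last first.
  by rewrite !mxE (negbTE ji) mulr0.
by rewrite !mxE !eqxx mulr1.
Qed.

End euclid.

(** * Sums over coordinate planes and averages of quadratic forms *)

Lemma rot_index_gt0 n : (1 < n)%N -> (0 < #|Defs.rot_index n|)%N.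
Proof.
move=> n1; apply/card_gt0P; have n0 : (0 < n)%N by exact: ltnW.
by exists (exist (fun p : 'I_n * 'I_n => p.1 < p.2)%N (Ordinal n0, Ordinal n1) isT).
Qed.

(** Passes from the ordered pairs of the Casimir operator to the pairs [i < j] drawn by the walk. *)
Lemma sum_rot_index (V : zmodType) n (f : 'I_n -> 'I_n -> V) :
  (forall i j, f j i = f i j) -> (forall i, f i i = 0) ->
  \sum_i \sum_j f i j = (\sum_(p : Defs.rot_index n) f (val p).1 (val p).2) *+ 2.
Proof.
move=> fC fii; rewrite pair_big/=.
rewrite (bigID (fun p : 'I_n * 'I_n => (p.1 < p.2)%N))/= mulr2n; congr (_ + _).
  exact: (big_sub (fun p : 'I_n * 'I_n => p.1 < p.2)%N (fun p => f p.1 p.2)).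
rewrite (bigID (fun p : 'I_n * 'I_n => p.1 == p.2))/= big1 ?add0r => [|[i j]/= /andP[_ /eqP->]];
  last exact: fii.
rewrite (reindex_inj (h := fun p : 'I_n * 'I_n => (p.2, p.1)))/=;
  last by case=> ? ? [? ?] [-> ->].
rewrite -(big_sub (fun p : 'I_n * 'I_n => p.1 < p.2)%N (fun p => f p.1 p.2)).
apply: eq_big => [[i j]|[i j] _] /=; last exact: fC.
by rewrite -leqNgt andbC -(inj_eq val_inj) eq_sym -ltn_neqAle.
Qed.

Lemma sum_delta2 (R : pzRingType) n (F : 'I_n -> 'I_n -> R) a b :
  \sum_p \sum_q F p q * ((a == p) && (b == q))%:R = F a b.
Proof.
rewrite (bigD1 a)//= [X in _ + X]big1 ?addr0 => [|p pa]; last first.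
  by apply: big1 => q _; rewrite eq_sym (negbTE pa) mulr0.
rewrite (bigD1 b)//= big1 ?addr0 => [|q qb]; last first.
  by rewrite [b == q]eq_sym (negbTE qb) andbF mulr0.
by rewrite !eqxx mulr1.
Qed.

(** Orthonormality of the columns of [c] kills the mixed terms of the expanded sum. This gives the
    invariance of the Casimir operator. *)
Lemma sum_orthonormal_gram (R : comPzRingType) (I : finType) m p (c : I -> I -> R)
    (X : I -> 'M[R]_(m, p)) :
  (forall s t, \sum_i c i s * c i t = (s == t)%:R) ->
  \sum_i (\sum_s c i s *: X s)^T *m (\sum_s c i s *: X s) = \sum_s (X s)^T *m X s.
Proof.
move=> cc; transitivity (\sum_i \sum_s \sum_t (c i s * c i t) *: ((X s)^T *m X t)).
  apply: eq_bigr => i _; have -> : (\sum_s c i s *: X s)^T = \sum_s c i s *: (X s)^T.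
    apply/matrixP => a b; rewrite mxE !summxE; apply: eq_bigr => s _.
    by rewrite !mxE.
  rewrite mulmx_suml; apply: eq_bigr => s _; rewrite mulmx_sumr; apply: eq_bigr => t _.
  by rewrite -scalemxAl -scalemxAr scalerA.
rewrite exchange_big; apply: eq_bigr => s _ /=; rewrite exchange_big (bigD1 s)//=.
rewrite -scaler_suml cc eqxx scale1r big1 ?addr0// => t ts.
by rewrite -scaler_suml cc eq_sym (negbTE ts) scale0r.
Qed.

(** The difference of the two sides is the average of the form at [u i - v]. *)
Lemma psd_jensen (R : realType) D (A : 'M[R]_D) (I : finType) (u : I -> 'cV[R]_D) v :
  psd A -> (0 < #|I|)%N -> v = #|I|%:R^-1 *: \sum_i u i ->
  dotv v (A *m v) <= #|I|%:R^-1 * \sum_i dotv (u i) (A *m u i).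
Proof.
move=> [sA pA] I0 vE; have N0 : 0 < #|I|%:R :> R by rewrite ltr0n.
have sumu : \sum_i u i = #|I|%:R *: v by rewrite vE scalerA mulfV ?scale1r// gt_eqF.
rewrite ler_pdivlMl//.
have : 0 <= \sum_i dotv (u i - v) (A *m (u i - v)) by exact: sumr_ge0.
have -> : \sum_i dotv (u i - v) (A *m (u i - v)) =
    \sum_i dotv (u i) (A *m u i) - #|I|%:R * dotv v (A *m v).
  transitivity (\sum_i (dotv (u i) (A *m u i) - dotv v (A *m u i) *+ 2 + dotv v (A *m v))).
    apply: eq_bigr => i _; rewrite mulmxBr !(dotvDl, dotvDr, dotvNl, dotvNr).
    by rewrite (psd_sym (u i) v sA); ring.
  rewrite big_split sumrB/= sumr_const sumrMnl -dotv_sumr -mulmx_sumr sumu.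
  by rewrite -scalemxAr dotvZr -[in LHS]mulr_natl; ring.
by rewrite subr_ge0.
Qed.

(** * Representations of SO(n) *)

Section representations.
Context {R : realType}.

(** Entrywise, so that products, Kronecker products and blocks reduce to the Leibniz rule for real
    functions. *)
Definition mx_derive m p (F F' : R -> 'M[R]_(m, p)) : Prop :=
  forall t i j, is_derive (t : R) (1 : R) (fun s => F s i j : R) (F' t i j).

Lemma mx_derive_mul m p q (A A' : R -> 'M[R]_(m, p)) (B B' : R -> 'M[R]_(p, q)) :
  mx_derive A A' -> mx_derive B B' ->
  mx_derive (fun t => A t *m B t) (fun t => A' t *m B t + A t *m B' t).
Proof.
move=> dA dB t i j.
have -> : (fun s => (A s *m B s) i j) =
    \sum_k (fun s => A s i k) * (fun s => B s k j).
  by apply/funext => s; rewrite mxE fct_sumE.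
rewrite !mxE -big_split/=; apply: is_derive_sum => k.
have h1 := dA t i k; have h2 := dB t k j.
by apply: is_derive_eq; rewrite /GRing.scale/=; ring.
Qed.

Lemma mx_derive_cst m p (A : 'M[R]_(m, p)) : mx_derive (fun=> A) (fun=> 0).
Proof. by move=> t i j; rewrite mxE; exact: is_derive_cst. Qed.

Lemma mx_derive_tens m p q r (A A' : R -> 'M[R]_(m, p)) (B B' : R -> 'M[R]_(q, r)) :
  mx_derive A A' -> mx_derive B B' ->
  mx_derive (fun t => A t *t B t) (fun t => A' t *t B t + A t *t B' t).
Proof.
move=> dA dB t i j.
case: (mxtens_indexP i) => i1 i2; case: (mxtens_indexP j) => j1 j2.
rewrite mxE !tensmxE.
have -> : (fun s => (A s *t B s) (mxtens_index (i1, i2)) (mxtens_index (j1, j2))) =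
    (fun s => A s i1 j1) * (fun s => B s i2 j2).
  by apply/funext => s; rewrite tensmxE.
have h1 := dA t i1 j1; have h2 := dB t i2 j2.
by apply: is_derive_eq; rewrite /GRing.scale/=; ring.
Qed.

Lemma mx_derive_block m p q r (A A' : R -> 'M[R]_(m, p)) (B B' : R -> 'M[R]_(q, r)) :
  mx_derive A A' -> mx_derive B B' ->
  mx_derive (fun t => block_mx (A t) 0 0 (B t)) (fun t => block_mx (A' t) 0 0 (B' t)).
Proof.
move=> dA dB t i j.
case: (split_ordP i) => i' ->; case: (split_ordP j) => j' ->.
- rewrite block_mxEul (_ : (fun s => _) = fun s => A s i' j'); first exact: dA.
  by apply/funext => s; rewrite block_mxEul.
- rewrite block_mxEur mxE (_ : (fun s => _) = cst 0); first exact: is_derive_cst.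
  by apply/funext => s; rewrite block_mxEur mxE.
- rewrite block_mxEdl mxE (_ : (fun s => _) = cst 0); first exact: is_derive_cst.
  by apply/funext => s; rewrite block_mxEdl mxE.
- rewrite block_mxEdr (_ : (fun s => _) = fun s => B s i' j'); first exact: dB.
  by apply/funext => s; rewrite block_mxEdr.
Qed.

Lemma rowsum_leD m p (a b : R) (A B : 'M[R]_(m, p)) :
  rowsum_le a A -> rowsum_le b B -> rowsum_le (a + b) (A + B).
Proof.
move=> hA hB i; apply: le_trans (lerD (hA i) (hB i)).
by rewrite -big_split; apply: ler_sum => j _; rewrite mxE ler_normD.
Qed.

Lemma rowsum_le_tens m p q r (a b : R) (A : 'M[R]_(m, p)) (B : 'M[R]_(q, r)) :
  rowsum_le a A -> rowsum_le b B -> rowsum_le (a * b) (A *t B).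
Proof.
move=> hA hB i; case: (mxtens_indexP i) => i1 i2.
have := ler_pM _ _ (hA i1) (hB i2); rewrite !sumr_ge0// => /(_ erefl erefl).
rewrite mulr_sum => /(le_trans _); apply; apply: ler_sum => j _.
by case: (mxtens_indexP j) => j1 j2; rewrite tensmxE normrM mxtens_indexK.
Qed.

Lemma rowsum_le1 m : rowsum_le 1 (1%:M : 'M[R]_m).
Proof.
move=> i; rewrite (bigD1 i)//= big1 ?addr0 => [|j ji]; first by rewrite mxE eqxx normr1.
by rewrite mxE eq_sym (negbTE ji) normr0.
Qed.

Lemma rowsum_le0 m p : rowsum_le 0 (0 : 'M[R]_(m, p)).
Proof. by move=> i; rewrite big1// => j _; rewrite mxE normr0. Qed.

Lemma rowsum_le_block m p q r (a : R) (A : 'M[R]_(m, p)) (B : 'M[R]_(q, r)) :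
  rowsum_le a A -> rowsum_le a B -> rowsum_le a (block_mx A 0 0 B).
Proof.
move=> hA hB i; rewrite big_split_ord/=; case: (split_ordP i) => i' ->.
  rewrite [X in _ + X]big1 ?addr0 => [|j _]; last by rewrite block_mxEur mxE normr0.
  by under eq_bigr do rewrite block_mxEul; exact: hA.
rewrite [X in X + _]big1 ?add0r => [|j _]; last by rewrite block_mxEdl mxE normr0.
by under eq_bigr do rewrite block_mxEdr; exact: hB.
Qed.

(** The derivative of [rot_mx i j] at angle 0. *)
Definition skewE n (i j : 'I_n) : 'M[R]_n := delta_mx i j - delta_mx j i.

(* [rho] stands for an orthogonal representation of SO(n), extended
   multiplicatively to all matrices, and [drho] for its differential; [K] bounds
   the weights of [rho]. *)
Record is_rep n D (K : R) (rho drho : 'M[R]_n -> 'M[R]_D) : Prop := IsRep {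
  rep1 : rho 1%:M = 1%:M;
  repM : forall g h, rho (g *m h) = rho g *m rho h;
  repT : forall g, rho g^T = (rho g)^T;
  drepP : forall s a b, drho (s *: a + b) = s *: drho a + drho b;
  drepT : forall a, drho a^T = (drho a)^T;
  drep_bracket : forall a b,
    drho (a *m b - b *m a) = drho a *m drho b - drho b *m drho a;
  drep_conj : forall g a, g^T *m g = 1%:M ->
    drho a *m rho g = rho g *m drho (g^T *m a *m g);
  rep_derive : forall i j, i != j ->
    mx_derive (fun t => rho (rot_mx i j t))
              (fun t => drho (skewE i j) *m rho (rot_mx i j t));
  drep_rowsum : forall i j, rowsum_le K (drho (skewE i j));
  rep_measurable : forall a b,
    measurable_fun setT (fun x : SO R n => rho (SO_mx x) a b) }.

Lemma rep_trivial n D :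
  is_rep 0 (fun _ : 'M[R]_n => 1%:M : 'M[R]_D) (fun _ : 'M[R]_n => 0 : 'M[R]_D).
Proof.
split => *; rewrite ?(mulmx1, mulmx0, mul0mx, trmx1, trmx0, subrr, scaler0, addr0)//.
- exact: mx_derive_cst.
- exact: rowsum_le0.
Qed.

Lemma mx_derive_rot n (i j : 'I_n) : i != j ->
  mx_derive (rot_mx i j) (fun t => skewE i j *m rot_mx i j t).
Proof.
move=> ij t a b; have ji : j != i by rewrite eq_sym.
have -> : (fun s => rot_mx i j s a b) =
    cst ((1%:M : 'M[R]_n) a b) 
    + (cos - cst 1) * cst ((delta_mx i i + delta_mx j j : 'M[R]_n) a b)
     + sin * cst ((delta_mx i j : 'M[R]_n) a b) - sin * cst ((delta_mx j i : 'M[R]_n) a b).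
  by apply/funext => s; rewrite /rot_mx !mxE/= !fctE.
have d c1 c2 c3 c4 : is_derive t 1 (cst c1 + (cos - cst 1) * cst c2 + sin * cst c3
    - sin * cst c4) (- sin t * c2 + cos t * c3 - cos t * c4 : R).
  have dk c : is_derive t (1 : R) (cst c : R -> R) 0 by exact: is_derive_cst.
  have dcos := is_deriveM (is_deriveB (is_derive_cos t) (dk 1)) (dk c2).
  have dsin c := is_deriveM (is_derive_sin t) (dk c).
  apply: is_derive_eq
    (is_deriveB (is_deriveD (is_deriveD (dk c1) dcos) (dsin c3)) (dsin c4)) _.
  by rewrite /GRing.scale/= /cst; ring.
apply: (is_derive_eq (d _ _ _ _)).
rewrite /rot_mx /skewE !(mulmxDl, mulmxDr, mulNmx, mulmxN, mulmx1).
rewrite -!(scalemxAr) !(mulmxDr, mulmxN).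
rewrite !mul_delta_mx_cond !eqxx (negbTE ij) (negbTE ji) !mulr0n !mulr1n.
by rewrite !mxE; ring.
Qed.

Lemma rep_standard n : is_rep 1 (fun g : 'M[R]_n => g) (fun a : 'M[R]_n => a).
Proof.
split; [by []|by []|by []|by []|by []|by []| | | |].
- by move=> g a gg; rewrite !mulmxA (mulmx1C gg) mul1mx.
- exact: mx_derive_rot.
(* A row of [skewE i j] has at most one nonzero entry, equal to 1 or -1. *)
- move=> i j a; rewrite /skewE; have [->|ij] := eqVneq i j.
    by rewrite subrr; apply: (le_trans (@rowsum_le0 n n a)).
  apply: le_trans (_ : \sum_b `|(a == i)%:R * (b == j)%:R - (a == j)%:R * (b == i)%:R| <= _).
    by apply: ler_sum => b _; rewrite !mxE -!natrM !mulnb.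
  have [->|ai] := eqVneq a i.
    rewrite (negbTE ij) (bigD1 j)//= big1 ?addr0 => [|b bj].
      by rewrite eqxx mul0r subr0 mul1r normr1.
    by rewrite (negbTE bj) mul0r mulr0 subrr normr0.
  have [_|aj] := eqVneq a j.
    rewrite (bigD1 i)//= big1 ?addr0 => [|b bj].
      by rewrite eqxx mul0r sub0r mul1r normrN normr1.
    by rewrite (negbTE bj) mul0r mulr0 subrr normr0.
  by rewrite big1// => b _; rewrite !mul0r subrr normr0.
- exact: measurable_SO_coord.
Qed.

Lemma tensmx_id m n : (1%:M : 'M[R]_m) *t (1%:M : 'M[R]_n) = 1%:M.
Proof.
apply/matrixP => i j; case: (mxtens_indexP i) => i1 i2.
case: (mxtens_indexP j) => j1 j2; rewrite tensmxE !mxE.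
by rewrite (inj_eq (can_inj (@mxtens_indexK m n))) xpair_eqE -natrM mulnb.
Qed.

(** Weights add under tensor products, which is why polynomials of degree [k] only see weights up to
    [k]. *)
Lemma rep_tens n D E K L (r dr : 'M[R]_n -> 'M[R]_D) (s ds : 'M[R]_n -> 'M[R]_E) :
  is_rep K r dr -> is_rep L s ds ->
  is_rep (K + L) (fun g => r g *t s g) (fun a => dr a *t 1%:M + 1%:M *t ds a).
Proof.
move=> [r1 rM rT dP dT dB dC rD dS rm] [s1 sM sT eP eT eB eC sD eS sm]; split.
- by rewrite r1 s1 tensmx_id.
- by move=> g h; rewrite rM sM tensmx_mul.
- by move=> g; rewrite rT sT trmx_tens.
- move=> t a b; rewrite dP eP.
  by apply/matrixP => i j; rewrite !mxE; ring.
- by move=> a; rewrite dT eT linearD/= !trmx_tens !trmx1.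
- move=> a b; rewrite dB eB !(mulmxDl, mulmxDr) !tensmx_mul !(mulmx1, mul1mx).
  by apply/matrixP => i j; rewrite !mxE; ring.
- move=> g a gg; rewrite mulmxDl mulmxDr !tensmx_mul !(mulmx1, mul1mx).
  by rewrite dC// eC.
- move=> i j ij; have := mx_derive_tens (rD i j ij) (sD i j ij).
  rewrite /mx_derive => h t a b; have := h t a b.
  by rewrite mulmxDl !tensmx_mul !mul1mx.
- move=> i j; apply: rowsum_leD.
    by rewrite -[K]mulr1; apply: rowsum_le_tens => //; exact: rowsum_le1.
  by rewrite -[L]mul1r; apply: rowsum_le_tens => //; exact: rowsum_le1.
- move=> a b; case: (mxtens_indexP a) => a1 a2; case: (mxtens_indexP b) => b1 b2.
  under eq_fun do rewrite tensmxE.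
  exact: measurable_funM.
Qed.

Lemma rep_sum n D E K (r dr : 'M[R]_n -> 'M[R]_D) (s ds : 'M[R]_n -> 'M[R]_E) :
  is_rep K r dr -> is_rep K s ds ->
  is_rep K (fun g => block_mx (r g) 0 0 (s g)) (fun a => block_mx (dr a) 0 0 (ds a)).
Proof.
move=> [r1 rM rT dP dT dB dC rD dS rm] [s1 sM sT eP eT eB eC sD eS sm]; split.
- by rewrite r1 s1 -scalar_mx_block.
- by move=> g h; rewrite rM sM mulmx_block !(mulmx0, mul0mx, addr0, add0r).
- by move=> g; rewrite rT sT tr_block_mx !trmx0.
- by move=> t a b; rewrite dP eP scale_block_mx add_block_mx !scaler0 !addr0.
- by move=> a; rewrite dT eT tr_block_mx !trmx0.
- move=> a b; rewrite dB eB !mulmx_block !(mulmx0, mul0mx, addr0, add0r).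
  by rewrite opp_block_mx add_block_mx !subrr.
- by move=> g a gg; rewrite !mulmx_block !(mulmx0, mul0mx, addr0, add0r) dC// eC.
- move=> i j ij; have := mx_derive_block (rD i j ij) (sD i j ij).
  rewrite /mx_derive => h t a b; have := h t a b.
  by rewrite mulmx_block !(mulmx0, mul0mx, addr0, add0r).
- by move=> i j; exact: rowsum_le_block.
- move=> a b; case: (split_ordP a) => a' ->; case: (split_ordP b) => b' ->.
  + rewrite (_ : (fun x => _) = fun x => r (SO_mx x) a' b'); first exact: rm.
    by apply/funext => x; rewrite block_mxEul.
  + rewrite (_ : (fun x => _) = cst 0); first exact: measurable_cst.
    by apply/funext => x; rewrite block_mxEur mxE.
  + rewrite (_ : (fun x => _) = cst 0); first exact: measurable_cst.
    by apply/funext => x; rewrite block_mxEdl mxE.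
  + rewrite (_ : (fun x => _) = fun x => s (SO_mx x) a' b'); first exact: sm.
    by apply/funext => x; rewrite block_mxEdr.
Qed.

Lemma rep_weaken n D K L (r dr : 'M[R]_n -> 'M[R]_D) :
  K <= L -> is_rep K r dr -> is_rep L r dr.
Proof.
by move=> KL [? ? ? ? ? ? ? ? dS ?]; split => // i j a; exact: le_trans (dS i j a) KL.
Qed.

End representations.

(** * Expectations of bounded functions *)

Section bounded_expectation.
Context {R : realType} {d : measure_display} {T : measurableType d}.
Implicit Types (mu : probability T R) (f g : T -> R).

(** Matrix coefficients on a compact group are bounded, so this class has every integral used below
    and is closed under products. *)
Definition bmeas f : Prop :=
  measurable_fun setT f /\ exists K, forall x, `|f x| <= K.

Definition Ex mu f : R := \int[mu]_x f x.

Lemma bmeas_integrable mu f : bmeas f -> mu.-integrable setT (EFin \o f).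
Proof.
move=> [mf [K fK]]; apply: measurable_bounded_integrable => //.
  by rewrite /= (probability_setT mu) ltry.
by exists K; split; [exact: num_real|move=> M KM x _; exact: le_trans (fK x) (ltW KM)].
Qed.

Lemma bmeas_cst c : bmeas (fun=> c).
Proof. by split; [exact: measurable_cst|exists `|c|]. Qed.

Lemma bmeasD f g : bmeas f -> bmeas g -> bmeas (fun x => f x + g x).
Proof.
move=> [mf [K fK]] [mg [L gL]]; split; first exact: measurable_funD.
by exists (K + L) => x; rewrite (le_trans (ler_normD _ _))// lerD.
Qed.

Lemma bmeasM f g : bmeas f -> bmeas g -> bmeas (fun x => f x * g x).
Proof.
move=> [mf [K fK]] [mg [L gL]]; split; first exact: measurable_funM.
by exists (K * L) => x; rewrite normrM ler_pM.
Qed.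

Lemma bmeasZ c f : bmeas f -> bmeas (fun x => c * f x).
Proof. by move=> bf; apply: bmeasM => //; exact: bmeas_cst. Qed.

Lemma bmeasB f g : bmeas f -> bmeas g -> bmeas (fun x => f x - g x).
Proof.
move=> bf bg; rewrite (_ : (fun x => _) = fun x => f x + -1 * g x).
  by apply: bmeasD => //; exact: bmeasZ.
by apply/funext => x; rewrite mulN1r.
Qed.

Lemma bmeas_sum (I : Type) (s : seq I) (P : pred I) (F : I -> T -> R) :
  (forall i, bmeas (F i)) -> bmeas (fun x => \sum_(i <- s | P i) F i x).
Proof.
move=> bF; elim: s => [|i s IH].
  rewrite (_ : (fun x => _) = fun=> 0); first exact: bmeas_cst.
  by apply/funext => x; rewrite big_nil.
rewrite (_ : (fun x => _) =
  fun x => (if P i then F i x else 0) + \sum_(i <- s | P i) F i x).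
  by apply: bmeasD => //; case: (P i) => //; exact: bmeas_cst.
by apply/funext => x; rewrite big_cons; case: ifP => //; rewrite add0r.
Qed.

Lemma ExD mu f g : bmeas f -> bmeas g -> Ex mu (fun x => f x + g x) = Ex mu f + Ex mu g.
Proof. by move=> bf bg; apply: RintegralD => //; exact: bmeas_integrable. Qed.

Lemma ExZ mu c f : bmeas f -> Ex mu (fun x => c * f x) = c * Ex mu f.
Proof. by move=> bf; apply: RintegralZl => //; exact: bmeas_integrable. Qed.

Lemma ExB mu f g : bmeas f -> bmeas g -> Ex mu (fun x => f x - g x) = Ex mu f - Ex mu g.
Proof. by move=> bf bg; apply: RintegralB => //; exact: bmeas_integrable. Qed.

Lemma Ex_cst mu c : Ex mu (fun=> c) = c.
Proof. by rewrite /Ex Rintegral_cst//= (probability_setT mu) mulr1. Qed.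

Lemma Ex_sum mu (I : Type) (s : seq I) (P : pred I) (F : I -> T -> R) :
  (forall i, bmeas (F i)) ->
  Ex mu (fun x => \sum_(i <- s | P i) F i x) = \sum_(i <- s | P i) Ex mu (F i).
Proof.
move=> bF; elim: s => [|i s IH].
  rewrite big_nil -[RHS](Ex_cst mu); congr Ex.
  by apply/funext => x; rewrite big_nil.
rewrite big_cons -IH (_ : (fun x => _) =
  fun x => (if P i then F i x else 0) + \sum_(i <- s | P i) F i x); last first.
  by apply/funext => x; rewrite big_cons; case: ifP => //; rewrite add0r.
rewrite ExD; [|by case: (P i) => //; exact: bmeas_cst|exact: bmeas_sum].
by case: (P i) => //; rewrite Ex_cst add0r.
Qed.

Lemma Ex_ge0 mu f : (forall x, 0 <= f x) -> 0 <= Ex mu f.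
Proof. by move=> f0; apply: Rintegral_ge0. Qed.

Lemma ExE mu f : bmeas f -> fine 'E_mu[f] = Ex mu f.
Proof. by rewrite unlock. Qed.

Lemma Ex_fin mu f : bmeas f -> (\int[mu]_x (f x)%:E)%E = (Ex mu f)%:E.
Proof.
move=> bf; rewrite /Ex /Rintegral fineK//.
by apply: integrable_fin_num => //; exact: bmeas_integrable.
Qed.

Lemma variance_Ex mu f : bmeas f ->
  fine (variance mu f) = Ex mu (fun x => (f x - Ex mu f) ^+ 2).
Proof.
move=> bf; rewrite /variance unlock ExE//.
  by congr Ex; apply/funext => x /=; rewrite ExE// expr2.
by apply: bmeasM; apply: bmeasB => //; exact: bmeas_cst.
Qed.

(* Reduces linearity statements for [Ex] to non-negative integrands. *)
Lemma Ex_shift f : bmeas f -> exists g K, [/\ bmeas g, forall x, 0 <= g x,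
  f = (fun x => g x - K) & forall mu, Ex mu f = Ex mu g - K].
Proof.
move=> bf; have [mf [K fK]] := bf; exists (fun x => f x + K), K.
have bg : bmeas (fun x => f x + K) by apply: bmeasD => //; exact: bmeas_cst.
have fE : f = (fun x => f x + K - K) by apply/funext => x; rewrite addrK.
split => // [x|mu];
  first by rewrite -lerBlDr sub0r; have := fK x; rewrite ler_norml => /andP[].
rewrite {1}fE ExB//; last exact: bmeas_cst.
by rewrite Ex_cst.
Qed.

Lemma Ex_eq_measure mu (nu : probability T R) f : (forall A, measurable A -> mu A = nu A) ->
  Ex mu f = Ex nu f.
Proof.
move=> mn; rewrite /Ex /Rintegral; congr fine.
by apply: eq_measure_integral => A mA _; exact: mn.
Qed.

Lemma Ex_mixture (I : finType) (m0 : probability T R) (m : I -> probability T R) f :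
  (0 < #|I|)%N -> bmeas f ->
  Ex (uniform_mixture m0 m) f = #|I|%:R^-1 * \sum_i Ex (m i) f.
Proof.
move=> I0 /Ex_shift[g [K [bg g0 _ fE]]]; rewrite !fE.
under eq_bigr do rewrite fE.
rewrite sumrB mulrBr sumr_const.
have -> : #|I|%:R^-1 * (K *+ #|I|) = K by rewrite -(mulr_natl K) mulKf// pnatr_eq0 -lt0n.
congr (_ - _).
have /card_gt0P[i0 _] := I0.
have w0 : 0 <= #|I|%:R^-1 :> R by rewrite invr_ge0.
(* For nonempty [I] the mixture is a scaled finite sum of measures; [i0] is only the default of
   [nth]. *)
rewrite /Ex /Rintegral (eq_measure_integral
  (mscale (NngNum w0) (msum (fun k => m (nth i0 (enum I) k)) #|I|))) => [|A mA _]; last first.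
  rewrite /= /uniform_mixture gtn_eqF// /mscale /msum /=; congr (_ * _)%E.
  by rewrite -big_enum /= (big_nth i0) -cardE big_mkord.
have mg : measurable_fun setT (EFin \o g) by apply/measurable_EFinP; exact: bg.1.
have g0E x : setT x -> (0 <= (g x)%:E)%E by move=> _; rewrite lee_fin.
rewrite ge0_integral_mscale// ge0_integral_measure_sum//=.
rewrite (eq_bigr (fun k : 'I_#|I| => (Ex (m (nth i0 (enum I) k)) g)%:E)) => [|k _];
  last exact: Ex_fin.
rewrite sumEFin/=; congr (_ * _).
rewrite -[RHS]big_enum /= (big_nth i0) -cardE big_mkord.
by apply: eq_bigr.
Qed.

Lemma Ex_dirac (x : T) f : bmeas f -> Ex (\d_x : probability T R) f = f x.
Proof.
move=> bf; rewrite /Ex /Rintegral integral_dirac//; first by rewrite diracE in_setT mul1e.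
by apply/measurable_EFinP; exact: bf.1.
Qed.

End bounded_expectation.

Lemma bmeas_comp (R : realType) d d' (S : measurableType d) (T : measurableType d')
    (phi : S -> T) (f : T -> R) :
  measurable_fun setT phi -> bmeas f -> bmeas (fun x => f (phi x)).
Proof.
move=> mphi [mf [K fK]]; split; first exact: measurableT_comp.
by exists K.
Qed.

Section bounded_expectation2.
Context {R : realType} {d d' : measure_display}.
Context {S : measurableType d} {T : measurableType d'}.

Lemma Ex_distribution (mu : probability S R) (phi : {mfun S >-> T}) (f : T -> R) :
  bmeas f -> Ex (distribution mu phi) f = Ex mu (fun x => f (phi x)).
Proof.
move=> bf; rewrite /Ex /Rintegral integral_distribution//.
  by apply/measurable_EFinP; exact: bf.1.
by apply: (@bmeas_integrable _ _ _ mu (fun x => f (phi x))); exact: bmeas_comp.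
Qed.

Lemma Ex_prod (mu : probability S R) (nu : probability T R) (f : S -> R) (g : T -> R) :
  bmeas f -> bmeas g ->
  Ex (mu \x nu)%E (fun xy => f xy.1 * g xy.2) = Ex mu f * Ex nu g.
Proof.
move=> bf bg; have bfg : bmeas (fun xy : S * T => f xy.1 * g xy.2).
  by apply: bmeasM; [exact: (bmeas_comp (@measurable_fst _ _ S T) bf)|
    exact: (bmeas_comp (@measurable_snd _ _ S T) bg)].
rewrite /Ex /Rintegral -integral12_prod_meas1/=;
  last exact: (bmeas_integrable (mu \x nu)%E bfg).
rewrite (eq_integral (fun x => (Ex nu g * f x)%:E)) => [|x _].
  rewrite (Ex_fin mu (bmeasZ (Ex nu g) bf)) (ExZ mu (Ex nu g) bf) mulrC.
  reflexivity.
by rewrite /fubini_F/= (Ex_fin nu (bmeasZ (f x) bg)) ExZ// mulrC.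
Qed.

End bounded_expectation2.

(** * Expectations of matrix-valued functions *)

Section matrix_expectation.
Context {R : realType} {d : measure_display} {T : measurableType d}.
Context (mu : probability T R).

Definition bmeas_mx m p (F : T -> 'M[R]_(m, p)) : Prop :=
  forall i j, bmeas (fun t => F t i j).

Definition ExM m p (F : T -> 'M[R]_(m, p)) : 'M[R]_(m, p) :=
  \matrix_(i, j) Ex mu (fun t => F t i j).

Lemma bmeas_mx_cst m p (A : 'M[R]_(m, p)) : bmeas_mx (fun=> A).
Proof. by move=> i j; exact: bmeas_cst. Qed.

Lemma bmeas_mx_tr m p (F : T -> 'M[R]_(m, p)) :
  bmeas_mx F -> bmeas_mx (fun t => (F t)^T).
Proof.
by move=> bF i j; rewrite (_ : (fun t => _) = fun t => F t j i)//;
  apply/funext => t; rewrite mxE.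
Qed.

Lemma bmeas_mx_mul m p q (F : T -> 'M[R]_(m, p)) (G : T -> 'M[R]_(p, q)) :
  bmeas_mx F -> bmeas_mx G -> bmeas_mx (fun t => F t *m G t).
Proof.
move=> bF bG i j; rewrite (_ : (fun t => _) = fun t => \sum_k F t i k * G t k j).
  by apply: bmeas_sum => k; exact: bmeasM.
by apply/funext => t; rewrite mxE.
Qed.

Lemma bmeas_mxB m p (F G : T -> 'M[R]_(m, p)) :
  bmeas_mx F -> bmeas_mx G -> bmeas_mx (fun t => F t - G t).
Proof.
move=> bF bG i j; rewrite (_ : (fun t => _) = fun t => F t i j - G t i j).
  exact: bmeasB.
by apply/funext => t; rewrite !mxE.
Qed.

Lemma ExM_cst m p (A : 'M[R]_(m, p)) : ExM (fun=> A) = A.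
Proof. by apply/matrixP => i j; rewrite mxE Ex_cst. Qed.

Lemma ExM_tr m p (F : T -> 'M[R]_(m, p)) : ExM (fun t => (F t)^T) = (ExM F)^T.
Proof.
by apply/matrixP => i j; rewrite !mxE; congr Ex; apply/funext => t; rewrite mxE.
Qed.

Lemma ExM_mull m p q (A : 'M[R]_(m, p)) (F : T -> 'M[R]_(p, q)) :
  bmeas_mx F -> ExM (fun t => A *m F t) = A *m ExM F.
Proof.
move=> bF; apply/matrixP => i j; rewrite !mxE.
rewrite (_ : (fun t => _) = fun t => \sum_k A i k * F t k j).
  by rewrite Ex_sum => [|k]; [apply: eq_bigr => k _; rewrite mxE ExZ|exact: bmeasZ].
by apply/funext => t; rewrite mxE.
Qed.

Lemma ExM_mulr m p q (A : 'M[R]_(p, q)) (F : T -> 'M[R]_(m, p)) :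
  bmeas_mx F -> ExM (fun t => F t *m A) = ExM F *m A.
Proof.
move=> bF; apply: trmx_inj; rewrite -ExM_tr trmx_mul -ExM_tr -ExM_mull;
  last exact: bmeas_mx_tr.
by congr ExM; apply/funext => t; rewrite trmx_mul.
Qed.

Lemma ExMB m p (F G : T -> 'M[R]_(m, p)) : bmeas_mx F -> bmeas_mx G ->
  ExM (fun t => F t - G t) = ExM F - ExM G.
Proof.
move=> bF bG; apply/matrixP => i j; rewrite !mxE -ExB//; congr Ex.
by apply/funext => t; rewrite !mxE.
Qed.

Lemma bmeas_dotv m (c : 'cV[R]_m) (F : T -> 'cV[R]_m) : bmeas_mx F ->
  bmeas (fun t => dotv c (F t)).
Proof. by move=> bF; apply: bmeas_sum => i; apply: bmeasM => //; exact: bmeas_cst. Qed.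

Lemma Ex_dotv m (c : 'cV[R]_m) (F : T -> 'cV[R]_m) : bmeas_mx F ->
  Ex mu (fun t => dotv c (F t)) = dotv c (ExM F).
Proof.
move=> bF; rewrite Ex_sum => [|i]; last by apply: bmeasM => //; exact: bmeas_cst.
by apply: eq_bigr => i _; rewrite mxE ExZ.
Qed.

End matrix_expectation.

(** * Averages over a uniform angle *)

Section angle_average.
Context {R : realType}.

Lemma mx_derive_continuous m p (F F' : R -> 'M[R]_(m, p)) i j : mx_derive F F' ->
  continuous (fun t => F t i j).
Proof.
move=> dF t; apply/differentiable_continuous/derivable1_diffP.
by have [] := dF t i j.
Qed.

(** The fundamental theorem of calculus over one full period. *)
Lemma Ex_angle_derive (F F' : R -> R) :
  (forall t : R, is_derive t (1 : R) F (F' t)) -> continuous F' ->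
  (exists K, forall t, `|F' t| <= K) -> F (pi *+ 2) = F 0 ->
  Ex (uniform_angle R) F' = 0.
Proof.
move=> dF cF' [K F'K] F2pi.
have mF' : measurable_fun setT F' by exact: continuous_measurable_fun.
have bF' : bmeas (F' : measurableTypeR R -> R) by split => //; exists K.
have bK : bmeas (fun=> K : R) := bmeas_cst K.
(* Adding [K] makes the integrand nonnegative, as [integral_uniform] asks; the primitive gains
   [K * t], whose normalised increment is [K]. *)
pose f t := F' t + K; pose G t := F t + K * t.
have f0 t : 0 <= f t by rewrite /f -lerBlDr sub0r; have := F'K t; rewrite ler_norml => /andP[].
have cf : continuous f.
  by move=> t; apply: cvgD; [exact: cF'|exact: cvg_cst].
have dG (t : R) : is_derive t (1 : R) G (f t).
  have h1 := dF t.
  by apply: is_derive_eq; rewrite /f /GRing.scale/= mulr1.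
have cG : continuous G.
  by move=> t; apply/differentiable_continuous/derivable1_diffP; have [] := dG t.
have -> : Ex (uniform_angle R) F' = Ex (uniform_angle R) f - K.
  by rewrite ExD// Ex_cst addrK.
have p0 := two_pi_gt0 R.
rewrite /Ex /Rintegral integral_uniform; last 2 first.
- by apply/measurable_EFinP; exact: continuous_measurable_fun.
- by move=> t; rewrite lee_fin.
rewrite (continuous_FTC2 p0 (F := G)) /=.
- rewrite /G F2pi mulr0 addr0 subr0 [F 0 + _]addrC addrK.
  by rewrite mulrCA mulVf ?mulr1 ?subrr// gt_eqF.
- by apply: continuous_subspaceT.
- split.
  + by move=> t _; have [] := dG t.
  + by apply: cvg_at_right_filter; exact: cG.
  + by apply: cvg_at_left_filter; exact: cG.
- by move=> t _; rewrite derive1E; have [_ ->] := dG t.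
Qed.

End angle_average.

(** * Givens rotations *)

Section givens.
Context {R : realType}.

(** The angle is the polar angle of [(u, v)]; at the origin any angle works. *)
Lemma givens_angle (u v : R) :
  exists t, 0 <= cos t * u + sin t * v /\ cos t * v - sin t * u = 0.
Proof.
have [uv0|uv0] := eqVneq (u ^+ 2 + v ^+ 2) 0.
  exists 0; rewrite cos0 sin0.
  have /eqP : u ^+ 2 + v ^+ 2 = 0 by [].
  by rewrite paddr_eq0 ?sqr_ge0// !sqrf_eq0 => /andP[/eqP-> /eqP->]; lra.
pose r := Num.sqrt (u ^+ 2 + v ^+ 2).
have s0 : 0 <= u ^+ 2 + v ^+ 2 by rewrite addr_ge0 ?sqr_ge0.
have r0 : 0 < r by rewrite sqrtr_gt0 lt_neqAle eq_sym uv0.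
have r2 : r ^+ 2 = u ^+ 2 + v ^+ 2 by rewrite sqr_sqrtr.
have ur : -1 <= u / r <= 1.
  rewrite -ler_norml normrM normfV (gtr0_norm r0) ler_pdivrMr// mul1r.
  by rewrite -(@ler_pXn2r _ 2) ?nnegrE ?(ltW r0)// r2 real_normK ?num_real// lerDl sqr_ge0.
have vr : Num.sqrt (1 - (u / r) ^+ 2) = `|v| / r.
  rewrite -[RHS]ger0_norm ?divr_ge0 ?(ltW r0)// -sqrtr_sqr; congr Num.sqrt.
  rewrite expr_div_n [in RHS]expr_div_n real_normK ?num_real// r2.
  by field.
(* [acos] only reaches angles with nonnegative sine, so the sign of [v] decides between the angle
   and its opposite. *)
have [t [ct st]] : exists t, cos t = u / r /\ sin t = v / r.
  have [v0|v0] := leP 0 v.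
    by exists (acos (u / r)); rewrite acosK// sin_acos// vr ger0_norm.
  by exists (- acos (u / r)); rewrite cosN sinN acosK// sin_acos// vr ltr0_norm// mulNr opprK.
exists t; rewrite ct st; split; last by ring.
have -> : u / r * u + v / r * v = r ^+ 2 / r by rewrite r2; ring.
by rewrite divr_ge0 ?sqr_ge0 ?(ltW r0).
Qed.

Lemma rot_mxE n (i j : 'I_n) t (x : 'M[R]_n) a b : i != j ->
  (rot_mx i j t *m x) a b =
    if a == i then cos t * x i b + sin t * x j b
    else if a == j then cos t * x j b - sin t * x i b else x a b.
Proof.
move=> ij; have dE p q : (delta_mx p q *m x) a b = (a == p)%:R * x q b.
  rewrite mxE (bigD1 q)//= big1 ?addr0 => [|c cq]; first by rewrite mxE eqxx andbT.
  by rewrite mxE (negbTE cq) andbF mul0r.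
have -> : (rot_mx i j t *m x) a b = x a b
    + (cos t - 1) * ((a == i)%:R * x i b + (a == j)%:R * x j b)
    + sin t * ((a == i)%:R * x j b) - sin t * ((a == j)%:R * x i b).
  rewrite -!dE /rot_mx !(mulmxDl, mulNmx) mul1mx -!scalemxAl mulmxDl.
  by rewrite !mxE.
have [->|ai] := eqVneq a i; first by rewrite (negbTE ij)/=; ring.
by have [->|aj] := eqVneq a j => /=; ring.
Qed.

(* Givens elimination: clear the columns one after the other; the invariant
   that the pivot is non-negative forces it to be 1, except in the last column
   where the determinant does. *)
Lemma SO_givens_ind n (P : 'M[R]_n -> Prop) : P 1%:M ->
  (forall i j t x, i != j -> P (rot_mx i j t *m x) -> P x) ->
  forall x, SO_set x -> P x.
Proof.
move=> P1 PR.
(* The first [m] columns are already those of the identity. *)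
pose good m (x : 'M[R]_n) := forall a b : 'I_n, (b < m)%N -> x a b = (a == b)%:R.
suff main d : forall m, (n - m = d)%N -> (m <= n)%N -> forall x, SO_set x -> good m x -> P x.
  by move=> x sx; apply: (main n 0%N) => //; rewrite subn0.
elim: d => [|d IH] m nm mn x sx gx.
  have <- : 1%:M = x => //; apply/matrixP => a b; rewrite mxE gx//.
  by have := ltn_ord b; lia.
have mn' : (m < n)%N by lia.
pose c := Ordinal mn'.
(* Inner induction down column [m]: rows strictly between [m] and [l] are cleared, and the pivot is
   known to be nonnegative once a rotation has been applied. *)
suff elim e : forall l, (n - l = e)%N -> (m < l)%N -> forall x, SO_set x -> good m x ->
    (forall a : 'I_n, (m < a < l)%N -> x a c = 0) -> ((m.+1 < l)%N -> 0 <= x c c) -> P x.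
  by apply: (elim (n - m.+1)%N m.+1) => // [a|]; [lia|rewrite ltnn].
elim: e => [|e IHe] l nl ml {}x {}sx {}gx x0 xc.
  (* Entries above the pivot vanish because column [c] is orthogonal to the earlier columns, which
     are basis vectors. *)
  have xac (a : 'I_n) : a != c -> x a c = 0.
    move=> ac; have [am|ma] := ltnP a m; last first.
      apply: x0; have := ltn_ord a; have : (a != m :> nat) by [].
      by lia.
    have /matrixP/(_ a c) := mulmx1C sx.1; rewrite !mxE (negbTE ac) mulr0n => <-.
    rewrite (bigD1 a)//= mxE (gx a a)// eqxx mul1r big1 ?addr0// => b ba.
    by rewrite mxE (gx b a)// (negbTE ba) mul0r.
  have xcc : x c c = 1.
    have x1 : x c c ^+ 2 = 1.
      have /matrixP/(_ c c) := mulmx1C sx.1; rewrite !mxE eqxx mulr1n => <-.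
      rewrite (bigD1 c)//= mxE expr2 big1 ?addr0// => b bc.
      by rewrite xac// mulr0.
    (* Before the last column the sign excludes -1; in the last column the matrix is diagonal and
       its determinant is the pivot. *)
    have [mn1|mn1] := ltnP m.+1 n.
      have xc0 : 0 <= x c c by apply: xc; lia.
      by move/eqP: x1; rewrite sqrf_eq1 => /orP[/eqP//|/eqP xN]; lra.
    have xD : x = diag_mx (\row_b (if b == c then x c c else 1)).
      apply/matrixP => a b; rewrite !mxE; have [->|bc] := eqVneq b c.
        by have [->|ac] := eqVneq a c; rewrite ?mulr1n// xac.
      rewrite (gx a b); first by have [->|] := eqVneq a b; rewrite ?(negbTE bc).
      by have := ltn_ord b; have : (b != m :> nat) by []; lia.
    have := sx.2; rewrite {1}xD det_diag (bigD1 c)//= big1 ?mulr1 => [|b bc].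
      by rewrite mxE eqxx.
    by rewrite mxE (negbTE bc).
  apply: (IH m.+1) => //; first by lia.
  move=> a b; rewrite ltnS leq_eqVlt => /predU1P[bm|bm]; last exact: gx.
  have -> : b = c by apply: val_inj.
  by have [->|ac] := eqVneq a c; [|exact: xac].
have ln : (l < n)%N by lia.
pose r := Ordinal ln.
have cr : c != r by rewrite -(inj_eq val_inj)/=; lia.
have [t [t0 t1]] := givens_angle (x c c) (x r c).
apply: (PR c r t) => //; apply: (IHe l.+1) => //; [lia|lia| | | |].
- exact: SO_setM (SO_set_rot_mx t cr) sx.
- move=> a b bm; rewrite rot_mxE// !gx//.
  have cb : (c == b) = false by apply/negbTE; rewrite -(inj_eq val_inj)/=; lia.
  have rb : (r == b) = false by apply/negbTE; rewrite -(inj_eq val_inj)/=; lia.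
  rewrite cb rb !mulr0 addr0 subr0.
  have [->|ac] := eqVneq a c; first by rewrite cb.
  by have [->|ar] := eqVneq a r; first by rewrite rb.
- move=> a /andP[ma al]; rewrite rot_mxE// ifN; last first.
    by rewrite -(inj_eq val_inj)/=; lia.
  have [//|ar] := eqVneq a r; apply: x0.
  by have : (a != l :> nat) by []; lia.
- by move=> _; rewrite rot_mxE// eqxx.
Qed.

End givens.

(** * Left translations and Haar expectations *)

Section haar_invariance.
Context {R : realType} {n : nat}.

Lemma SO_mx_inj : injective (@SO_mx R n).
Proof. exact: val_inj. Qed.

Lemma SO_orth (x : SO R n) : (SO_mx x)^T *m SO_mx x = 1%:M.
Proof. exact: mulmx1C (SO_mxP x).1. Qed.

Lemma SO_set_tr (A : 'M[R]_n) : SO_set A -> SO_set A^T.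
Proof. by move=> [AA dA]; split; rewrite ?trmxK ?det_tr//; exact: mulmx1C. Qed.

Definition SO_inv (x : SO R n) : SO R n := mkSO (SO_set_tr (SO_mxP x)).

Lemma SO_mxM (x y : SO R n) : SO_mx (SO_mul x y) = SO_mx x *m SO_mx y.
Proof. by []. Qed.

Lemma SO_mxV (x : SO R n) : SO_mx (SO_inv x) = (SO_mx x)^T.
Proof. by []. Qed.

Lemma SO_mulVx (g x : SO R n) : SO_mul g (SO_mul (SO_inv g) x) = x.
Proof. by apply: SO_mx_inj; rewrite !SO_mxM SO_mxV mulmxA (SO_mxP g).1 mul1mx. Qed.

Lemma measurable_SO_mul (g : SO R n) : measurable_fun [set: SO R n] (SO_mul g).
Proof.
apply: measurable_fun_SO => i j.
rewrite (_ : (fun t => _) = fun t => \sum_k SO_mx g i k * SO_mx t k j).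
  apply: measurable_sum => l; apply: measurable_funM => //.
  exact: measurable_SO_coord.
by apply/funext => t; rewrite SO_mxM mxE.
Qed.

HB.instance Definition _ g :=
  isMeasurableFun.Build _ _ _ _ (SO_mul g) (measurable_SO_mul g).

Lemma Ex_haar (H : probability (SO R n) R) (g : SO R n) f : is_haar H -> bmeas f ->
  Ex H (fun x => f (SO_mul g x)) = Ex H f.
Proof.
move=> hH bf; rewrite -(Ex_distribution H (SO_mul g) bf).
apply: Ex_eq_measure => A mA; rewrite /distribution /pushforward /=.
have mgA : measurable (SO_mul g @^-1` A).
  by rewrite -[X in measurable X]setTI; exact: measurable_SO_mul.
(* [is_haar] speaks of images and the change of variables of preimages; they match because left
   translation is onto. *)
apply: etrans (esym (hH g _ mgA)) _; rewrite image_preimage//.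
by apply/seteqP; split => // x _; exists (SO_mul (SO_inv g) x) => //; exact: SO_mulVx.
Qed.

End haar_invariance.

(** * The walk in a representation *)

Section orthogonal_representation.
Context {R : realType} {n D : nat} {k : R} {rho drho : 'M[R]_n -> 'M[R]_D}.
Hypothesis rep : is_rep k rho drho.

Lemma rep_orth (g : 'M[R]_n) : g^T *m g = 1%:M -> (rho g)^T *m rho g = 1%:M.
Proof. by move=> gg; rewrite -(repT rep) -(repM rep) gg (rep1 rep). Qed.

Lemma rep_bounded (g : 'M[R]_n) a b : g^T *m g = 1%:M -> `|rho g a b| <= 1.
Proof.
move=> gg; have /matrixP/(_ b b) := rep_orth gg; rewrite !mxE eqxx => h.
rewrite -(@expr_le1 _ 2)// -normrX ger0_norm ?sqr_ge0// -[leRHS]h.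
rewrite (bigD1 a)//= mxE expr2 lerDl sumr_ge0// => c _.
by rewrite mxE -expr2 sqr_ge0.
Qed.

Lemma rot_orth (i j : 'I_n) (t : R) : i != j -> (rot_mx i j t)^T *m rot_mx i j t = 1%:M.
Proof. by move=> ij; rewrite tr_rot_mx rot_mxD// addNr rot_mx0. Qed.

Lemma drepD a b : drho (a + b) = drho a + drho b.
Proof. by rewrite -[a]scale1r (drepP rep) !scale1r. Qed.

Lemma drep0 : drho 0 = 0.
Proof. by apply: (addrI (drho 0)); rewrite -drepD !addr0. Qed.

Lemma drepZ s a : drho (s *: a) = s *: drho a.
Proof. by rewrite -[s *: a]addr0 (drepP rep) drep0 addr0. Qed.

Lemma drepN a : drho (- a) = - drho a.
Proof. by rewrite -scaleN1r drepZ scaleN1r. Qed.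

Lemma drep_sum (I : finType) (F : I -> 'M[R]_n) :
  drho (\sum_i F i) = \sum_i drho (F i).
Proof. exact: (big_morph drho drepD drep0). Qed.

Lemma skewE_tr (i j : 'I_n) : (skewE i j)^T = - skewE i j :> 'M[R]_n.
Proof. by rewrite /skewE linearB/= !trmx_delta opprB. Qed.

Lemma skewEC (i j : 'I_n) : skewE j i = - skewE i j :> 'M[R]_n.
Proof. by rewrite /skewE opprB. Qed.

Lemma skewEii (i : 'I_n) : skewE i i = 0 :> 'M[R]_n.
Proof. by rewrite /skewE subrr. Qed.

Definition gen (i j : 'I_n) : 'M[R]_D := drho (skewE i j).

Lemma gen_tr i j : (gen i j)^T = - gen i j.
Proof. by rewrite -(drepT rep) skewE_tr drepN. Qed.

Lemma genC i j : gen j i = - gen i j.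
Proof. by rewrite /gen skewEC drepN. Qed.

Lemma gen_ii i : gen i i = 0.
Proof. by rewrite /gen skewEii drep0. Qed.

Lemma skewE_comm (i j b : 'I_n) : i != j -> i != b -> j != b ->
  [/\ skewE i b *m skewE j b - skewE j b *m skewE i b = - skewE i j :> 'M[R]_n,
      skewE i j *m skewE i b - skewE i b *m skewE i j = - skewE j b :> 'M[R]_n &
      skewE i j *m skewE j b - skewE j b *m skewE i j = skewE i b :> 'M[R]_n].
Proof.
move=> ij ib jb; have [ji bi bj] : [/\ j != i, b != i & b != j].
  by rewrite ![_ == i]eq_sym ![b == j]eq_sym.
rewrite /skewE; split; rewrite !(mulmxDl, mulmxDr, mulNmx, mulmxN) !mul_delta_mx_cond
  !eqxx ?(negbTE ij, negbTE ib, negbTE jb, negbTE ji, negbTE bi, negbTE bj)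
  !mulr0n !mulr1n; apply/matrixP => u v; rewrite !mxE; ring.
Qed.

(** The orthogonal projection onto the kernel of [gen i j], for [i != j]: the mean of [rho] over a
    circle subgroup. *)
Definition rotE (i j : 'I_n) : 'M[R]_D :=
  ExM (uniform_angle R) (fun t => rho (rot_mx i j t)).

Lemma rep_rot_derive i j : i != j ->
  mx_derive (fun t => rho (rot_mx i j t)) (fun t => gen i j *m rho (rot_mx i j t)).
Proof. exact: (rep_derive rep). Qed.

Lemma bmeas_rep_rot i j : i != j ->
  bmeas_mx (fun t : measurableTypeR R => rho (rot_mx i j t)).
Proof.
move=> ij a b; split.
  apply: continuous_measurable_fun.
  exact: (mx_derive_continuous (rep_rot_derive ij)).
by exists 1 => t; apply: rep_bounded; exact: rot_orth.
Qed.

Lemma rot2pi i j : rot_mx i j (pi *+ 2 : R) = 1%:M :> 'M[R]_n.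
Proof. by rewrite /rot_mx cos2pi sin2pi subrr !scale0r !addr0 subr0. Qed.

(** The generator times the rotation is the derivative of a periodic function of the angle, hence
    has mean zero. *)
Lemma gen_rotE i j : i != j -> gen i j *m rotE i j = 0.
Proof.
move=> ij; rewrite -ExM_mull; last exact: bmeas_rep_rot.
apply/matrixP => a b; rewrite !mxE.
apply: (@Ex_angle_derive _ (fun t => rho (rot_mx i j t) a b)).
- by move=> t; exact: rep_rot_derive.
- apply: (@mx_derive_continuous _ _ _ _
    (fun t => gen i j *m (gen i j *m rho (rot_mx i j t)))) => t c e.
  have := mx_derive_mul (mx_derive_cst (gen i j)) (rep_rot_derive ij) t c e.
  by rewrite mul0mx add0r.
- have [_ [K hK]] := bmeas_mx_mul (bmeas_mx_cst (gen i j)) (bmeas_rep_rot ij) a b.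
  by exists K.
- by rewrite rot2pi rot_mx0.
Qed.

Lemma rot_gen i j t : i != j ->
  gen i j *m rho (rot_mx i j t) = rho (rot_mx i j t) *m gen i j.
Proof.
move=> ij; rewrite (drep_conj rep _ (rot_orth t ij)); congr (_ *m drho _).
rewrite -mulmxA; have -> : skewE i j *m rot_mx i j t = rot_mx i j t *m skewE i j.
  have ji : j != i by rewrite eq_sym.
  rewrite /rot_mx /skewE !(mulmxDl, mulmxDr, mulNmx, mulmxN, mulmx1, mul1mx).
  rewrite -!(scalemxAr, scalemxAl) !(mulmxDr, mulmxDl, mulmxN, mulNmx).
  rewrite !mul_delta_mx_cond !eqxx (negbTE ij) (negbTE ji) !mulr0n !mulr1n.
  by apply/matrixP => u v; rewrite !mxE; ring.
by rewrite mulmxA rot_orth// mul1mx.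
Qed.

(** The generator commutes with its own rotations, so the derivative in [t] vanishes and the value
    at angle 0 persists. *)
Lemma rot_fixed i j m (C : 'M[R]_(D, m)) : i != j -> gen i j *m C = 0 ->
  forall t, rho (rot_mx i j t) *m C = C.
Proof.
move=> ij ZC t; apply/matrixP => a b.
have d0 (s : R) : is_derive s (1 : R) (fun s => (rho (rot_mx i j s) *m C) a b : R) 0.
  have := mx_derive_mul (rep_rot_derive ij) (mx_derive_cst C) s a b.
  by rewrite mulmx0 addr0 rot_gen// -mulmxA ZC mulmx0 mxE.
by rewrite (is_derive_0_is_cst t 0 d0) rot_mx0 (rep1 rep) mul1mx.
Qed.

Lemma rotE_fixed i j m (C : 'M[R]_(D, m)) : i != j -> gen i j *m C = 0 ->
  rotE i j *m C = C.
Proof.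
move=> ij ZC; rewrite -ExM_mulr; last exact: bmeas_rep_rot.
rewrite -[RHS](ExM_cst (uniform_angle R)); congr ExM.
by apply/funext => t; exact: rot_fixed.
Qed.

Lemma rotE_idem i j : i != j -> rotE i j *m rotE i j = rotE i j.
Proof. by move=> ij; apply: rotE_fixed => //; exact: gen_rotE. Qed.

(** A transposed rotation is a rotation by the opposite angle and fixes the range of [rotE]. Hence
    the symmetric matrix [(rotE i j)^T *m rotE i j] equals [rotE i j]. *)
Lemma rotE_tr i j : i != j -> (rotE i j)^T = rotE i j.
Proof.
move=> ij; have EE : (rotE i j)^T *m rotE i j = rotE i j.
  rewrite -ExM_tr -ExM_mulr; last exact/bmeas_mx_tr/bmeas_rep_rot.
  rewrite -[RHS](ExM_cst (uniform_angle R)); congr ExM.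
  apply/funext => t; rewrite -(repT rep) tr_rot_mx.
  by apply: rot_fixed => //; exact: gen_rotE.
by rewrite -EE trmx_mul trmxK.
Qed.

Lemma comm_rotE i j (A : 'M[R]_D) : i != j ->
  (forall g, g^T *m g = 1%:M -> \det g = 1 -> A *m rho g = rho g *m A) ->
  A *m rotE i j = rotE i j *m A.
Proof.
move=> ij cA; have bR := bmeas_rep_rot ij; rewrite -ExM_mull// -ExM_mulr//.
congr ExM; apply/funext => t; apply: cA; first exact: rot_orth.
by have [] := SO_set_rot_mx t ij.
Qed.

(** * The Casimir operator and its invariance *)

Definition casimir : 'M[R]_D := \sum_i \sum_j (gen i j)^T *m gen i j.

Lemma psd_casimir : psd casimir.
Proof. by do 2 apply: psd_sum => ?; exact: psd_gram. Qed.

Lemma casimirE u : dotv u (casimir *m u) =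
  \sum_i \sum_j dotv (gen i j *m u) (gen i j *m u).
Proof.
rewrite mulmx_suml dotv_sumr; apply: eq_bigr => i _.
rewrite mulmx_suml dotv_sumr; apply: eq_bigr => j _.
by rewrite dotv_mulmxl mulmxA.
Qed.

(** Ordered pairs make the coefficients those of the Kronecker square of [g], which is orthogonal
    when [g] is. *)
Lemma conj_skewE (g : 'M[R]_n) i j : g^T *m skewE i j *m g =
  \sum_p \sum_q (g i p * g j q) *: skewE p q.
Proof.
apply/matrixP => a b; rewrite mulmxBr mulmxBl !mxE.
have tE (i' j' : 'I_n) : (g^T *m delta_mx i' j' *m g) a b = g i' a * g j' b.
  rewrite mxE (bigD1 j')//= big1 ?addr0 => [|c cj]; last first.
    rewrite mxE big1 ?mul0r// => e _; rewrite !mxE (negbTE cj) andbF mulr0//.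
  rewrite mxE (bigD1 i')//= big1 ?addr0 => [|c ci]; last first.
    by rewrite !mxE (negbTE ci) mulr0.
  by rewrite !mxE !eqxx mulr1.
have := tE i j; have := tE j i; rewrite !mxE => -> ->.
rewrite summxE; under eq_bigr do rewrite summxE.
under eq_bigr do under eq_bigr do rewrite !mxE mulrBr.
under eq_bigr do rewrite sumrB.
rewrite sumrB sum_delta2; congr (_ - _).
rewrite exchange_big/= -(sum_delta2 (fun q p => g j q * g i p)).
by apply: eq_bigr => q _; apply: eq_bigr => p _; rewrite andbC [g j q * _]mulrC.
Qed.

(** Conjugation by [rho g] mixes the generators with orthonormal coefficients, which leaves the sum
    of their Gram matrices unchanged. *)
Lemma casimir_comm (g : 'M[R]_n) : g^T *m g = 1%:M ->
  casimir *m rho g = rho g *m casimir.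
Proof.
move=> gg; have rr := mulmx1C (rep_orth gg).
have gE (a b : 'I_n) : \sum_i g i a * g i b = (a == b)%:R.
  have /matrixP/(_ a b) := gg; rewrite !mxE => <-.
  by apply: eq_bigr => i _; rewrite mxE.
suff inv : (rho g)^T *m casimir *m rho g = casimir.
  by rewrite -{2}inv !mulmxA rr mul1mx.
pose X p q := gen p q.
have genE i j : gen i j *m rho g = rho g *m \sum_p \sum_q (g i p * g j q) *: X p q.
  rewrite /gen (drep_conj rep _ gg) conj_skewE drep_sum; congr (_ *m _).
  apply: eq_bigr => p _; rewrite drep_sum; apply: eq_bigr => q _.
  exact: drepZ.
rewrite mulmx_sumr mulmx_suml.
transitivity (\sum_i \sum_j (\sum_p \sum_q (g i p * g j q) *: X p q)^T *m
    (\sum_p \sum_q (g i p * g j q) *: X p q)).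
  apply: eq_bigr => i _; rewrite mulmx_sumr mulmx_suml; apply: eq_bigr => j _.
  rewrite mulmxA -trmx_mul -mulmxA genE trmx_mul -mulmxA.
  by rewrite [_ *m (rho g *m _)]mulmxA (rep_orth gg) mul1mx.
pose Y (p : 'I_n * 'I_n) := X p.1 p.2; pose c (i p : 'I_n * 'I_n) := g i.1 p.1 * g i.2 p.2.
rewrite /casimir !pair_big/= -(sum_orthonormal_gram (c := c) Y) => [|s t].
  by apply: eq_bigr => i _; rewrite !pair_big.
transitivity (\sum_i \sum_j (g i s.1 * g i t.1) * (g j s.2 * g j t.2)).
  by rewrite pair_big; apply: eq_bigr => -[i j] _; rewrite /c/=; ring.
under eq_bigr do rewrite -mulr_sumr gE.
by rewrite -mulr_suml gE -natrM mulnb -xpair_eqE -!surjective_pairing.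
Qed.

Lemma casimir_rotE i j : i != j -> casimir *m rotE i j = rotE i j *m casimir.
Proof. by move=> ij; apply: comm_rotE => // g gg _; exact: casimir_comm. Qed.

(** * Contraction of the Casimir form by one step *)

Hypothesis k1 : 1 <= k.

Lemma gen_weight_bound i j b u : i != j -> i != b -> j != b ->
  dotv (gen i j *m u) (gen i j *m u) <=
  k * (dotv (gen i b *m u) (gen i b *m u) + dotv (gen j b *m u) (gen j b *m u)).
Proof.
move=> ij ib jb; have [h1 h2 h3] := skewE_comm ij ib jb.
apply: so3_weight_bound; rewrite ?gen_tr//.
- by rewrite /gen -(drep_bracket rep) h1 drepN.
- by rewrite /gen -(drep_bracket rep) h2 drepN.
- by rewrite /gen -(drep_bracket rep) h3.
- exact: lt_le_trans k1.
- exact: (drep_rowsum rep).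
Qed.

(** Among ordered pairs, those meeting [i] or [j] count the plane [i, j] twice and, for each of the
    [n - 2] other indices [b], the planes [i, b] and [j, b] twice. Each such [b] contributes at
    least [2 / k] copies of the plane [i, j]. *)
Lemma casimir_ge_gen i j u : i != j ->
  2 * (n.-1%:R / k) * dotv (gen i j *m u) (gen i j *m u) <= dotv u (casimir *m u).
Proof.
move=> ij; have k0 : 0 < k by exact: lt_le_trans k1.
pose s a b := dotv (gen a b *m u) (gen a b *m u).
have s_ge0 a b : 0 <= s a b by exact: dotv_ge0.
have sC a b : s b a = s a b by rewrite /s genC mulNmx dotvNl dotvNr opprK.
have sii a : s a a = 0 by rewrite /s gen_ii mul0mx dotv0l.
rewrite casimirE -/(s i j).
have rest : n.-2%:R * (s i j / k) <= \sum_(b | (b != i) && (b != j)) (s i b + s j b).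
  apply: le_trans (_ : \sum_(b | (b != i) && (b != j)) (s i j / k) <= _); last first.
    apply: ler_sum => b /andP[bi bj]; rewrite ler_pdivrMr// mulrC.
    by apply: gen_weight_bound => //; rewrite eq_sym.
  rewrite sumr_const mulr_natl le_eqVlt; apply/orP; left; apply/eqP; congr (_ *+ _).
  have := cardC (pred2 i j); rewrite card2 ij card_ord => /(congr1 (fun m => m - 2)%N).
  rewrite addKn subn2 => <-; apply: eq_card => b.
  by rewrite !inE negb_or.
have ji : j != i by rewrite eq_sym.
have Fi : s i j + \sum_(b | (b != i) && (b != j)) s i b <= \sum_b s i b.
  by rewrite [leRHS](bigD1 i)//= sii add0r [leRHS](bigD1 j)//=.
have Fj : s i j + \sum_(b | (b != i) && (b != j)) s j b <= \sum_b s j b.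
  by rewrite [leRHS](bigD1 i)//= sC lerD2l [leRHS](bigD1 j)//= sii add0r.
have Fa a : s i a + s j a <= \sum_b s a b.
  by rewrite [leRHS](bigD1 i)//= sC lerD2l (bigD1 j)//= sC lerDl sumr_ge0.
pose F a := \sum_b s a b.
have -> : \sum_a \sum_b dotv (gen a b *m u) (gen a b *m u) =
    F i + (F j + \sum_(a | (a != i) && (a != j)) F a).
  by rewrite -/(\sum_a F a) (bigD1 i)//= (bigD1 (F := F) j).
apply: le_trans (_ : _ <= (s i j + \sum_(b | (b != i) && (b != j)) s i b) +
  ((s i j + \sum_(b | (b != i) && (b != j)) s j b) +
   \sum_(b | (b != i) && (b != j)) (s i b + s j b))) _; last first.
  by rewrite lerD// lerD// ler_sum.
move: rest; rewrite big_split/=; set A := \sum_(b | _) s i b; set B := \sum_(b | _) s j b.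
(* As [k >= 1], the plane [i, j] itself pays for the missing index, raising [n - 2] to [n - 1]. *)
have : s i j / k <= s i j by rewrite ler_pdivrMr// ler_peMr.
have -> : 2 * (n.-1%:R / k) * s i j = 2 * (n.-1%:R * (s i j / k)) by ring.
have : n.-1%:R * (s i j / k) <= n.-2%:R * (s i j / k) + s i j / k.
  rewrite -[X in _ <= _ + X]mul1r -mulrDl ler_wpM2r ?divr_ge0//; first exact: ltW.
  by rewrite natr1 ler_nat; case: (n) => [|[]].
lra.
Qed.

(** The Casimir operator commutes with the projection, so its form splits over [rotE u] and the rest
    [w]; [casimir_ge_gen] applies to [w], on which [gen i j] acts as on [u]. *)
Lemma rotE_contraction i j u : i != j ->
  dotv (rotE i j *m u) (casimir *m (rotE i j *m u)) <=
  dotv u (casimir *m u) - 2 * (n.-1%:R / k) * dotv (gen i j *m u) (gen i j *m u).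
Proof.
move=> ij; pose v := rotE i j *m u; pose w := u - v.
have uE : u = v + w by rewrite addrC subrK.
have Zw : gen i j *m w = gen i j *m u.
  by rewrite mulmxBr mulmxA gen_rotE// mul0mx subr0.
have Ew : rotE i j *m w = 0.
  by rewrite mulmxBr mulmxA rotE_idem// subrr.
have vw : dotv v (casimir *m w) = 0.
  rewrite dotv_mulmxl rotE_tr// mulmxA -casimir_rotE// -mulmxA Ew.
  by rewrite mulmx0 dotv0r.
clearbody w; have := casimir_ge_gen w ij; rewrite Zw -/v.
have -> : dotv u (casimir *m u) = dotv v (casimir *m v) + dotv w (casimir *m w).
  rewrite {1 2}uE mulmxDr !(dotvDl, dotvDr) vw.
  by rewrite (psd_sym w v psd_casimir.1) vw addr0 add0r.
lra.
Qed.

Definition kac_mx : 'M[R]_D :=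
  #|Defs.rot_index n|%:R^-1 *: \sum_(p : Defs.rot_index n) rotE (val p).1 (val p).2.

Lemma kac_mx_tr : kac_mx^T = kac_mx.
Proof.
apply/matrixP => a b; rewrite !mxE !summxE; congr (_ * _); apply: eq_bigr => p _.
by have /matrixP/(_ a b) := rotE_tr (rot_index_neq p); rewrite mxE.
Qed.

Lemma kac_mx_comm (A : 'M[R]_D) :
  (forall g, g^T *m g = 1%:M -> \det g = 1 -> A *m rho g = rho g *m A) ->
  A *m kac_mx = kac_mx *m A.
Proof.
move=> cA; rewrite /kac_mx -scalemxAl -scalemxAr; congr (_ *: _).
rewrite mulmx_sumr mulmx_suml; apply: eq_bigr => p _.
exact: (comm_rotE (rot_index_neq p)).
Qed.

(** By convexity the form of the average is at most the average of the forms. The losses of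
    [rotE_contraction] add up to a proportion [(n - 1) / (k N)], with [N] the number of planes. *)
Lemma kac_contraction u : (1 < n)%N ->
  dotv (kac_mx *m u) (casimir *m (kac_mx *m u)) <=
  (1 - (n%:R * k)^-1) * dotv u (casimir *m u).
Proof.
move=> n1; pose N := #|Defs.rot_index n|.
have k0 : 0 < k by exact: lt_le_trans k1.
have n0 : (0 < n)%N by exact: ltnW.
have N0 : (0 < N)%N by exact: rot_index_gt0.
(* This crude count suffices: it gives [N <= n (n - 1)] because [n <= 2 (n - 1)]. *)
have N2 : N%:R *+ 2 <= n%:R * n%:R :> R.
  have -> : N%:R = \sum_(p : Defs.rot_index n) ((val p).1 != (val p).2)%:R :> R.
    rewrite (eq_bigr (fun=> 1)) ?sumr_const// => p _.
    by have := rot_index_neq p => /= ->.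
  rewrite -(sum_rot_index (f := fun i j => (i != j)%:R)) => [|i j|i]; last 2 first.
  - by rewrite eq_sym.
  - by rewrite eqxx.
  apply: le_trans (_ : \sum_(i < n) \sum_(j < n) 1 <= _).
    by apply: ler_sum => i _; apply: ler_sum => j _; case: (_ == _).
  by rewrite !sumr_const !card_ord -mulrnA natrM.
set q := dotv u (casimir *m u).
have q0 : 0 <= q by exact: psd_casimir.2.
pose s (p : Defs.rot_index n) :=
  dotv (gen (val p).1 (val p).2 *m u) (gen (val p).1 (val p).2 *m u).
have qE : q = (\sum_p s p) *+ 2.
  rewrite /q casimirE (sum_rot_index (f := fun i j => dotv (gen i j *m u) (gen i j *m u)))//.
    by move=> i j; rewrite genC mulNmx dotvNl dotvNr opprK.
  by move=> i; rewrite gen_ii mul0mx dotv0l.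
have NR0 : 0 < N%:R :> R by rewrite ltr0n.
apply: (@le_trans _ _ (N%:R^-1 * \sum_p dotv (rotE (val p).1 (val p).2 *m u)
    (casimir *m (rotE (val p).1 (val p).2 *m u)))).
  apply: psd_jensen => //; first exact: psd_casimir.
  by rewrite -mulmx_suml scalemxAl.
apply: (@le_trans _ _ (N%:R^-1 * \sum_p (q - 2 * (n.-1%:R / k) * s p))).
  rewrite ler_pM2l ?invr_gt0//; apply: ler_sum => p _.
  exact: (rotE_contraction u (rot_index_neq p)).
rewrite sumrB sumr_const -/N -mulr_sumr.
have -> : 2 * (n.-1%:R / k) * \sum_p s p = n.-1%:R / k * q by rewrite qE; ring.
rewrite mulrBr -[q *+ N]mulr_natl mulKf ?gt_eqF// mulrBl mul1r lerD2l lerN2 mulrA ler_wpM2r//.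
have nn : n%:R = n.-1%:R + 1 :> R by rewrite natr1 prednK.
have n1R : 1 <= n.-1%:R :> R by rewrite ler1n; case: (n) n1 => [|[]].
rewrite invfM mulrA ler_wpM2r ?invr_ge0//; first exact: ltW.
rewrite mulrC ler_pdivlMr// mulrC ler_pdivrMr ?ltr0n//.
by move: N2; rewrite nn; nra.
Qed.

Definition orbit (e : 'cV[R]_D) (x : SO R n) : 'cV[R]_D := rho (SO_mx x) *m e.

Lemma bmeas_orbit e : bmeas_mx (orbit e).
Proof.
apply: bmeas_mx_mul; last exact: bmeas_mx_cst.
move=> a b; split; first exact: (rep_measurable rep).
by exists 1 => x; apply: rep_bounded; exact: SO_orth.
Qed.

Lemma orbitM e (g x : SO R n) : orbit e (SO_mul g x) = rho (SO_mx g) *m orbit e x.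
Proof. by rewrite /orbit SO_mxM (repM rep) mulmxA. Qed.

(** Independence of position and angle factors each entry of [rho (R x) e], and averaging the
    rotation factor produces [rotE]. *)
Lemma ExM_kac_step e (mu : probability (SO R n) R) : (1 < n)%N ->
  ExM (kac_step mu) (orbit e) = kac_mx *m ExM mu (orbit e).
Proof.
move=> n1; have N0 := rot_index_gt0 n1.
apply/matrixP => a b; rewrite ord1 mxE {b}.
rewrite (Ex_mixture _ _ N0); last exact: bmeas_orbit.
rewrite -scalemxAl mxE mulmx_suml summxE; congr (_ * _); apply: eq_bigr => p _.
rewrite Ex_distribution; last exact: bmeas_orbit.
rewrite (_ : (fun x => _) = fun xt : SO R n * measurableTypeR R =>
    \sum_c orbit e xt.1 c 0 * rho (rot_mx (val p).1 (val p).2 xt.2) a c); last first.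
  apply/funext => xt; rewrite orbitM mxE; apply: eq_bigr => c _.
  by rewrite mulrC.
have bR := bmeas_rep_rot (rot_index_neq p).
have bO := bmeas_orbit e.
rewrite Ex_sum => [|c]; last first.
  apply: bmeasM;
    first exact: (bmeas_comp (@measurable_fst _ _ (SO R n) (measurableTypeR R)) (bO c 0)).
  exact: (bmeas_comp (@measurable_snd _ _ (SO R n) (measurableTypeR R)) (bR a c)).
rewrite mxE; apply: eq_bigr => c _.
by rewrite (Ex_prod mu (uniform_angle R) (bO c 0) (bR a c)) [in RHS]mulrC !mxE.
Qed.

Lemma ExM_kac_law e T (x : SO R n) : (1 < n)%N ->
  ExM (kac_law T x) (orbit e) = iter T (mulmx kac_mx) (orbit e x).
Proof.
move=> n1; elim: T => [|T IH]; last by rewrite /= ExM_kac_step// IH.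
by apply/matrixP => a b; rewrite ord1 mxE; apply: Ex_dirac; exact: bmeas_orbit.
Qed.

(** * Haar covariance of an orbit *)

Context (H : probability (SO R n) R) (hH : is_haar H) (e : 'cV[R]_D).

Definition corbit (x : SO R n) : 'cV[R]_D := orbit e x - ExM H (orbit e).

(** Its quadratic form at [c] is the Haar variance of the function [dotv c (orbit e x)]. *)
Definition cov_mx : 'M[R]_D := ExM H (fun x => corbit x *m (corbit x)^T).

Lemma bmeas_corbit : bmeas_mx corbit.
Proof. by apply: bmeas_mxB; [exact: bmeas_orbit|exact: bmeas_mx_cst]. Qed.

Lemma ExM_haar m p (F : SO R n -> 'M[R]_(m, p)) g : bmeas_mx F ->
  ExM H (fun x => F (SO_mul g x)) = ExM H F.
Proof.
move=> bF; apply/matrixP => i j; rewrite !mxE.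
by rewrite -(Ex_haar g hH (bF i j)).
Qed.

Lemma mean_orbit_fixed (g : SO R n) :
  rho (SO_mx g) *m ExM H (orbit e) = ExM H (orbit e).
Proof.
rewrite -ExM_mull; last exact: bmeas_orbit.
rewrite -[RHS](ExM_haar g); last exact: bmeas_orbit.
by congr ExM; apply/funext => x; rewrite orbitM.
Qed.

Lemma corbitM (g x : SO R n) : corbit (SO_mul g x) = rho (SO_mx g) *m corbit x.
Proof. by rewrite /corbit orbitM mulmxBr mean_orbit_fixed. Qed.

Lemma ExM_corbit : ExM H corbit = 0.
Proof.
rewrite (ExMB H (bmeas_orbit e) (bmeas_mx_cst _)) ExM_cst.
exact: subrr.
Qed.

Lemma bmeas_cov : bmeas_mx (fun x => corbit x *m (corbit x)^T).
Proof. by apply: bmeas_mx_mul; [|apply: bmeas_mx_tr]; exact: bmeas_corbit. Qed.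

Lemma cov_mxE c c' : dotv c (cov_mx *m c') =
  Ex H (fun x => dotv c (corbit x) * dotv c' (corbit x)).
Proof.
rewrite -ExM_mulr; last exact: bmeas_cov.
rewrite -Ex_dotv; last by apply: bmeas_mx_mul; [exact: bmeas_cov|exact: bmeas_mx_cst].
congr Ex; apply/funext => x; rewrite -mulmxA (_ : _^T *m c' = (dotv c' (corbit x))%:M).
  by rewrite mul_mx_scalar dotvZr mulrC.
by rewrite [LHS]mx11_scalar -dotv_mx dotvC.
Qed.

Lemma psd_cov : psd cov_mx.
Proof.
split=> [|u]; last by rewrite cov_mxE; apply: Ex_ge0 => x; rewrite -expr2 sqr_ge0.
rewrite -ExM_tr; congr ExM; apply/funext => x.
by rewrite trmx_mul trmxK.
Qed.

Lemma SO_mx_mk g (gg : g^T *m g = 1%:M) (dg : \det g = 1) :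
  SO_mx (mkSO (conj (mulmx1C gg) dg) : SO R n) = g.
Proof. by []. Qed.

Lemma cov_mx_comm (g : 'M[R]_n) : g^T *m g = 1%:M -> \det g = 1 ->
  cov_mx *m rho g = rho g *m cov_mx.
Proof.
move=> gg dg; have rr := rep_orth gg.
pose h : SO R n := mkSO (conj (mulmx1C gg) dg).
have inv : rho g *m cov_mx *m (rho g)^T = cov_mx.
  rewrite -ExM_mull; last exact: bmeas_cov.
  rewrite -ExM_mulr; last by apply: bmeas_mx_mul; [exact: bmeas_mx_cst|exact: bmeas_cov].
  rewrite -[RHS](ExM_haar h); last exact: bmeas_cov.
  congr ExM; apply/funext => x; rewrite corbitM SO_mx_mk trmx_mul.
  by rewrite !mulmxA.
by rewrite -{1}inv -mulmxA rr mulmx1.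
Qed.

Lemma cov_kac_comm : cov_mx *m kac_mx = kac_mx *m cov_mx.
Proof. exact: (kac_mx_comm cov_mx_comm). Qed.

(* Transitivity of left translation makes the regularised reproducing kernel
   constant on the diagonal, hence at most its mean [tr (B G) <= D]. *)
Lemma corbit_sup_bound a x :
  dotv a (corbit x) ^+ 2 <= D%:R * dotv a (cov_mx *m a).
Proof.
have pG := psd_cov.
suff reg eps : 0 < eps ->
    dotv a (corbit x) ^+ 2 <= D%:R * dotv a (cov_mx *m a) + eps * (D%:R * dotv a a).
  have Da : 0 <= D%:R * dotv a a by rewrite mulr_ge0 ?dotv_ge0.
  apply/ler_addgt0Pr => del del0.
  (* The 1 in the denominator keeps it positive when [D] or [a] vanishes. *)
  have e0 : 0 < del / (D%:R * dotv a a + 1) by rewrite divr_gt0// ltr_wpDl.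
  apply: le_trans (reg _ e0) _; rewrite lerD2l mulrAC ler_pdivrMr ?ltr_wpDl//.
  by rewrite ler_wpM2l ?(ltW del0)// lerDl.
move=> eps0; have [B [pB AB BA trB]] := psd_regularized_inverse pG eps0.
pose K y := dotv (corbit y) (B *m corbit y).
have KM g y : K (SO_mul g y) = K y.
  have Br : B *m rho (SO_mx g) = rho (SO_mx g) *m B.
    have cA : (cov_mx + eps%:M) *m rho (SO_mx g) = rho (SO_mx g) *m (cov_mx + eps%:M).
      rewrite mulmxDl mulmxDr scalar_mxC; congr (_ + _).
      by apply: cov_mx_comm; [exact: SO_orth|exact: (SO_mxP g).2].
    rewrite -[LHS]mulmx1 -AB mulmxA -(mulmxA B) -cA (mulmxA B) BA.
    by rewrite mul1mx.
  rewrite /K corbitM (mulmxA B) Br dotv_mulmxl -mulmxA mulmxA.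
  by rewrite (rep_orth (SO_orth g)) mul1mx.
have Kx y : K y = K x.
  have -> : x = SO_mul (SO_mul x (SO_inv y)) y.
    by apply: SO_mx_inj; rewrite !SO_mxM SO_mxV -mulmxA SO_orth mulmx1.
  by rewrite KM.
have bK : bmeas K.
  apply: bmeas_sum => i; apply: bmeasM; first exact: bmeas_corbit.
  by apply: bmeas_mx_mul; [exact: bmeas_mx_cst|exact: bmeas_corbit].
have KD : K x <= D%:R.
  apply: le_trans trB; rewrite -[leLHS](Ex_cst H) -ExM_mull; last exact: bmeas_cov.
  rewrite /mxtrace; under eq_bigr do rewrite mxE.
  rewrite -Ex_sum => [|i]; last by apply: bmeas_mx_mul; [exact: bmeas_mx_cst|exact: bmeas_cov].
  rewrite le_eqVlt; apply/orP; left; apply/eqP; congr Ex; apply/funext => y.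
  rewrite -(Kx y) /K; apply: eq_bigr => i _.
  by rewrite mulmxA [RHS]mxE big_ord1 [(corbit y)^T _ _]mxE mulrC.
have pA : psd (cov_mx + eps%:M).
  split=> [|u]; first by rewrite linearD/= pG.1 tr_scalar_mx.
  rewrite mulmxDl mul_scalar_mx dotvDr dotvZr addr_ge0 ?pG.2//.
  by rewrite mulr_ge0 ?dotv_ge0 ?ltW.
(* In the regularised form, [a] paired with [B (corbit x)] is the value to bound, and the form at
   [B (corbit x)] is [K x]. *)
have := psd_cauchy_schwarz a (B *m corbit x) pA.
rewrite mulmxA AB mul1mx [dotv (B *m _) _]dotvC -/(K x) => /le_trans; apply.
have -> : dotv a ((cov_mx + eps%:M) *m a) = dotv a (cov_mx *m a) + eps * dotv a a.
  by rewrite mulmxDl mul_scalar_mx dotvDr dotvZr.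
have -> : D%:R * dotv a (cov_mx *m a) + eps * (D%:R * dotv a a) =
  (dotv a (cov_mx *m a) + eps * dotv a a) * D%:R by ring.
rewrite ler_wpM2l// addr_ge0 ?pG.2//.
by rewrite mulr_ge0 ?dotv_ge0 ?ltW.
Qed.

(** Each plane rotation fixes such a [C], and Givens elimination reaches all of SO(n). *)
Lemma casimir_ker_fixed m (C : 'M[R]_(D, m)) : (forall i j, gen i j *m C = 0) ->
  forall x, SO_set x -> rho x *m C = C.
Proof.
move=> ZC; apply: SO_givens_ind; first by rewrite (rep1 rep) mul1mx.
move=> i j t x ij; rewrite (repM rep) -mulmxA => h.
have := rot_fixed ij (ZC i j) (- t); rewrite -{1}h -tr_rot_mx (repT rep).
by rewrite mulmxA (rep_orth (rot_orth t ij)) mul1mx.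
Qed.

(** A zero sum of squares forces every generator to kill [c]. The function attached to [c] is then
    constant, so its centred version is zero. *)
Lemma casimir_ker_cov (c : 'cV[R]_D) : casimir *m c = 0 -> cov_mx *m c = 0.
Proof.
move=> Kc; have Zc i j : gen i j *m c = 0.
  apply/eqP; rewrite -dotv_eq0; apply/eqP.
  have := casimirE c; rewrite Kc dotv0r => /esym.
  move/psumr_eq0P => /(_ (fun i _ => sumr_ge0 _ (fun j _ => dotv_ge0 _))) /(_ i isT).
  by move/psumr_eq0P => /(_ (fun j _ => dotv_ge0 _)) /(_ j isT).
have dc x : dotv c (corbit x) = dotv c e - dotv c (ExM H (orbit e)).
  rewrite dotvBr; congr (_ - _); rewrite /orbit dotv_mulmxr.
  rewrite -[in LHS](casimir_ker_fixed Zc (SO_mxP x)) mulmxA.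
  by rewrite (rep_orth (SO_orth x)) mul1mx.
have dc0 x : dotv c (corbit x) = 0.
  have := Ex_dotv H c bmeas_corbit; rewrite ExM_corbit dotv0r.
  rewrite (_ : (fun t => _) = fun=> dotv c (corbit x)) ?Ex_cst//.
  by apply/funext => y; rewrite !dc.
apply/eqP; rewrite -dotv_eq0 cov_mxE (_ : (fun x => _) = fun=> 0) ?Ex_cst//.
by apply/funext => x; rewrite dc0 mulr0.
Qed.

(** Inclusion of kernels becomes divisibility on the right; this transfers decay from the Casimir
    form to the covariance. *)
Lemma cov_factor : exists X, cov_mx = X *m casimir.
Proof.
apply/submxP; rewrite submxE; apply/eqP/matrixP => a b.
have := @casimir_ker_cov (cokermx casimir *m delta_mx b 0).
rewrite mulmxA mulmx_coker mul0mx => /(_ erefl); rewrite mulmxA -colE => /matrixP/(_ a 0).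
by rewrite [LHS]mxE => ->; rewrite !mxE.
Qed.

Lemma dotv_iter (A : 'M[R]_D) t (u v : 'cV[R]_D) : A^T = A ->
  dotv (iter t (mulmx A) u) v = dotv u (iter t (mulmx A) v).
Proof.
move=> sA; elim: t v => [//|t IH] v.
by rewrite iterS dotv_mulmxl sA IH -iterSr.
Qed.

Lemma comm_iter (A B : 'M[R]_D) t (u : 'cV[R]_D) : A *m B = B *m A ->
  A *m iter t (mulmx B) u = iter t (mulmx B) (A *m u).
Proof. by move=> AB; elim: t => [//|t IH]; rewrite !iterS mulmxA AB -mulmxA IH. Qed.

(** * Decay of the Haar variance along the walk *)

Hypothesis n1 : (1 < n)%N.

Local Notation q := (1 - (n%:R * k)^-1).

Lemma rate_gt0 : 0 < q.
Proof.
have nk : 1 < n%:R * k.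
  by apply: (lt_le_trans (y := n%:R)); rewrite ?ltr1n// ler_peMr.
by rewrite subr_gt0 invf_lt1// (lt_trans ltr01).
Qed.

Lemma casimir_kac_iter t (c : 'cV[R]_D) :
  dotv (iter t (mulmx kac_mx) c) (casimir *m iter t (mulmx kac_mx) c) <=
  q ^+ t * dotv c (casimir *m c).
Proof.
elim: t => [|t IH]; first by rewrite expr0 mul1r.
rewrite iterS; apply: le_trans (kac_contraction _ n1) _.
by rewrite exprS -mulrA ler_wpM2l// ltW// rate_gt0.
Qed.

(** Moving all [2 t] steps to one side and factoring through the Casimir operator, Cauchy-Schwarz
    yields the square root of a decay [q ^+ (2 * t)], with a constant depending on [c]. *)
Lemma cov_kac_growth (c : 'cV[R]_D) : exists C, forall t,
  dotv (iter t (mulmx kac_mx) c) (cov_mx *m iter t (mulmx kac_mx) c) <= C * q ^+ t.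
Proof.
have [X GX] := cov_factor; have sM := kac_mx_tr.
pose Q u := dotv u (casimir *m u).
have Q0 u : 0 <= Q u by exact: (psd_casimir).2.
exists (Num.sqrt (Q (X^T *m c) * Q c)) => t.
set a := dotv _ _.
have -> : a = dotv (X^T *m c) (casimir *m iter (t + t) (mulmx kac_mx) c).
  rewrite /a dotv_iter// -(comm_iter _ _ cov_kac_comm) -iterD.
  by rewrite dotv_mulmxl trmxK mulmxA -GX.
have qt0 : 0 <= q ^+ t by rewrite exprn_ge0// ltW// rate_gt0.
have C0 : 0 <= Num.sqrt (Q (X^T *m c) * Q c) * q ^+ t by rewrite mulr_ge0 ?sqrtr_ge0.
apply: le_trans (ler_norm _) _; rewrite -(ger0_norm C0).
rewrite -ler_sqr ?nnegrE// !real_normK ?num_real//.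
apply: le_trans (psd_cauchy_schwarz _ _ psd_casimir) _.
rewrite exprMn sqr_sqrtr ?mulr_ge0// -mulrA ler_wpM2l//; first exact: Q0.
by rewrite -exprM muln2 -addnn mulrC; exact: casimir_kac_iter.
Qed.

(** Log-convexity along the orbit of the symmetric [kac_mx] discards the constant of
    [cov_kac_growth]. *)
Lemma cov_kac_contraction (c : 'cV[R]_D) :
  dotv (kac_mx *m c) (cov_mx *m (kac_mx *m c)) <= q * dotv c (cov_mx *m c).
Proof.
have [C hC] := cov_kac_growth c.
apply: (@log_convex_ratio _
  (fun t => let v := iter t (mulmx kac_mx) c in dotv v (cov_mx *m v)) C) => //.
- exact: rate_gt0.
- by move=> t; exact: psd_cov.2.
- apply: psd_orbit_log_convex; [exact: psd_cov|exact: cov_kac_comm|left].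
  exact: kac_mx_tr.
Qed.

Lemma cov_kac_iter t (c : 'cV[R]_D) :
  dotv (iter t (mulmx kac_mx) c) (cov_mx *m iter t (mulmx kac_mx) c) <=
  q ^+ t * dotv c (cov_mx *m c).
Proof.
elim: t => [|t IH]; first by rewrite expr0 mul1r.
rewrite iterS; apply: le_trans (cov_kac_contraction _) _.
by rewrite exprS -mulrA ler_wpM2l// ltW// rate_gt0.
Qed.

Lemma kac_mean_orbit : kac_mx *m ExM H (orbit e) = ExM H (orbit e).
Proof.
have N0 := rot_index_gt0 n1.
rewrite /kac_mx -scalemxAl mulmx_suml (eq_bigr (fun=> ExM H (orbit e))) => [|p _].
  by rewrite sumr_const -[X in _ *: X]scaler_nat scalerA mulVf ?scale1r// pnatr_eq0 -lt0n.
rewrite -ExM_mulr; last exact: (bmeas_rep_rot (rot_index_neq p)).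
rewrite -[RHS](ExM_cst (uniform_angle R)); congr ExM; apply/funext => t.
exact: (mean_orbit_fixed (Defs.rot p t)).
Qed.

(** The Haar mean is fixed by [kac_mx], so centring commutes with the walk. Symmetry then moves the
    steps onto [c], where the sup bound and the variance decay apply. *)
Lemma kac_moment_bound (c : 'cV[R]_D) T x f : f = (fun y => dotv c (orbit e y)) ->
  (Ex (kac_law T x) f - Ex H f) ^+ 2 <=
  D%:R * (q ^+ T * Ex H (fun y => (f y - Ex H f) ^+ 2)).
Proof.
move=> fdef; have bO := bmeas_orbit e.
have fE y : f y - Ex H f = dotv c (corbit y) by rewrite fdef Ex_dotv// -dotvBr.
have -> : Ex (kac_law T x) f - Ex H f =
    dotv c (iter T (mulmx kac_mx) (orbit e x) - ExM H (orbit e)).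
  by rewrite fdef !Ex_dotv// ExM_kac_law// -dotvBr.
have -> : iter T (mulmx kac_mx) (orbit e x) - ExM H (orbit e) =
    iter T (mulmx kac_mx) (corbit x).
  have itB t u v : iter t (mulmx kac_mx) (u - v) =
      iter t (mulmx kac_mx) u - iter t (mulmx kac_mx) v.
    by elim: t => [//|t IH]; rewrite !iterS IH mulmxBr.
  rewrite itB; congr (_ - _); elim: T => [//|T IH].
  by rewrite iterS -IH kac_mean_orbit.
rewrite -dotv_iter; last exact: kac_mx_tr.
apply: le_trans (corbit_sup_bound _ _) _; rewrite ler_wpM2l//.
apply: le_trans (cov_kac_iter _ _) _; rewrite cov_mxE le_eqVlt; apply/orP; left.
by apply/eqP; congr (_ * Ex _ _); apply/funext => y; rewrite fE expr2.
Qed.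

End orthogonal_representation.

(** * Polynomials as matrix coefficients *)

Section polynomial_representation.
Context {R : realType} (n : nat).

(** [n] copies of the standard representation, one per column, plus a trivial line supplying the
    constant 1. *)
Definition lrep (g : 'M[R]_n) : 'M[R]_(n * n + 1) :=
  block_mx (g *t (1%:M : 'M[R]_n)) 0 0 1%:M.

(** The zero terms keep the shape produced by [rep_tens] and [rep_sum]. *)
Definition dlrep (a : 'M[R]_n) : 'M[R]_(n * n + 1) :=
  block_mx (a *t (1%:M : 'M[R]_n) + (1%:M : 'M[R]_n) *t 0) 0 0 0.

Lemma rep_lrep : is_rep 1 lrep dlrep.
Proof.
apply: rep_sum; last by apply: rep_weaken (rep_trivial n 1); exact: ler01.
by apply: rep_weaken (rep_tens (rep_standard n) (rep_trivial n n)); rewrite addr0.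
Qed.

(** The identity matrix flattened, then 1, so that its orbit lists the entries of [x] and the
    constant 1. *)
Definition lvec : 'cV[R]_(n * n + 1) :=
  col_mx (\col_p ((mxtens_unindex p).1 == (mxtens_unindex p).2)%:R) 1%:M.

Lemma lrep_lvec (x : 'M[R]_n) :
  (forall i a, (lrep x *m lvec) (lshift 1 (mxtens_index (i, a))) 0 = x i a) /\
  (lrep x *m lvec) (rshift (n * n) 0) 0 = 1.
Proof.
rewrite mul_block_col !mul0mx addr0 add0r mul1mx; split=> [i a|]; last first.
  by rewrite col_mxEd mxE.
rewrite col_mxEu mxE (bigD1 (mxtens_index (a, a)))// big1 ?addr0 => [|p].
  by rewrite tensmxE !mxE mxtens_indexK !eqxx /= !mulr1 addr0.
case: (mxtens_indexP p) => b c.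
rewrite andTb (inj_eq (can_inj (@mxtens_indexK n n))) xpair_eqE tensmxE !mxE mxtens_indexK/=.
have [->|bc] := eqVneq b c; last by rewrite mulr0.
by rewrite andbb => ca; rewrite eq_sym (negbTE ca) mulr0 mul0r.
Qed.

Fixpoint pdim (k : nat) : nat := if k is k'.+1 then (n * n + 1) * pdim k' else 1.

Fixpoint prep k (g : 'M[R]_n) : 'M[R]_(pdim k) :=
  if k is k'.+1 then lrep g *t prep k' g else 1%:M.

Fixpoint dprep k (a : 'M[R]_n) : 'M[R]_(pdim k) :=
  if k is k'.+1 then
    dlrep a *t (1%:M : 'M[R]_(pdim k')) + (1%:M : 'M[R]_(n * n + 1)) *t dprep k' a
  else 0.

Fixpoint pvec k : 'cV[R]_(pdim k) :=
  if k is k'.+1 then lvec *t pvec k' else 1%:M.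

Lemma rep_prep k : is_rep k%:R (prep k) (dprep k).
Proof.
elim: k => [|k IH]; first exact: (rep_trivial n 1).
by rewrite -add1n natrD; exact: (rep_tens rep_lrep IH).
Qed.

Lemma pdimE k : pdim k = ((n * n + 1) ^ k)%N.
Proof. by elim: k => // k IH; rewrite expnS -IH. Qed.

Lemma dotv_tens p q (a u : 'cV[R]_p) (b v : 'cV[R]_q) :
  dotv (a *t b : 'cV[R]_(p * q)) (u *t v : 'cV[R]_(p * q)) = dotv a u * dotv b v.
Proof.
rewrite mulr_sum; apply: eq_bigr => i _; rewrite !mxE.
by rewrite !ord1; ring.
Qed.

Definition pspan k (f : SO R n -> R) : Prop :=
  exists c, f = fun x => dotv c (orbit (rho := prep k) (pvec k) x).

Lemma pspan_cst c : pspan 0 (fun=> c).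
Proof.
exists c%:M; apply/funext => x; rewrite /orbit mul1mx /dotv big_ord1 !mxE.
by rewrite mulr1.
Qed.

Lemma pspanD k f g : pspan k f -> pspan k g -> pspan k (fun x => f x + g x).
Proof. by move=> [c ->] [c' ->]; exists (c + c'); apply/funext => x; rewrite dotvDl. Qed.

Lemma pspanZ k a f : pspan k f -> pspan k (fun x => a * f x).
Proof. by move=> [c ->]; exists (a *: c); apply/funext => x; rewrite dotvZl. Qed.

(** Tensoring the coefficient vector with a basis vector selects one coordinate in the new
    factor. *)
Lemma pspanM k f p : pspan k f ->
  pspan k.+1 (fun x => (lrep (SO_mx x) *m lvec) p 0 * f x).
Proof.
move=> [c ->]; exists ((delta_mx p 0 : 'cV[R]_(n * n + 1)) *t c); apply/funext => x.
rewrite /orbit; have -> : prep k.+1 (SO_mx x) *m pvec k.+1 =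
    (lrep (SO_mx x) *m lvec) *t (prep k (SO_mx x) *m pvec k).
  exact: (tensmx_mul (lrep (SO_mx x)) (prep k (SO_mx x)) lvec (pvec k)).
rewrite dotv_tens; congr (_ * _); rewrite /dotv (bigD1 p)//= big1 ?addr0 => [|q qp].
  by rewrite [delta_mx _ _ _ _]mxE !eqxx mul1r.
by rewrite [delta_mx _ _ _ _]mxE (negbTE qp) mul0r.
Qed.

(** Multiplication by the constant coordinate, which pads lower degrees up to [k]. *)
Lemma pspanS k f : pspan k f -> pspan k.+1 f.
Proof.
move=> /(pspanM (rshift (n * n) 0)); congr (pspan _ _).
by apply/funext => x; rewrite (lrep_lvec (SO_mx x)).2 mul1r.
Qed.

Lemma pspan_le k l f : (k <= l)%N -> pspan k f -> pspan l f.
Proof.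
move=> /subnK <-; elim: (l - k)%N => // m IH /IH; exact: pspanS.
Qed.

Lemma pspan_coord k f (p : 'I_(n * n)) : pspan k f ->
  pspan k.+1 (fun x => mxvec (SO_mx x) 0 p * f x).
Proof.
case/mxvec_indexP: p => i a /(pspanM (lshift 1 (mxtens_index (i, a)))).
congr (pspan _ _); apply/funext => x.
by rewrite mxvecE (lrep_lvec (SO_mx x)).1.
Qed.

Lemma pspan_coord_exp k f (p : 'I_(n * n)) j : pspan k f ->
  pspan (j + k) (fun x => mxvec (SO_mx x) 0 p ^+ j * f x).
Proof.
move=> kf; elim: j => [|j IH].
  by rewrite add0n; congr (pspan _ _): kf; apply/funext => x; rewrite expr0 mul1r.
have := pspan_coord p IH; congr (pspan _ _).
by apply/funext => x; rewrite mulrA -exprS.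
Qed.

Lemma pspan_sum k (I : Type) (s : seq I) (F : I -> SO R n -> R) (P : pred I) :
  (forall i, P i -> pspan k (F i)) -> pspan k (fun x => \sum_(i <- s | P i) F i x).
Proof.
move=> hF; elim: s => [|i s IH].
  have := pspan_le (leq0n k) (pspan_cst 0).
  by congr (pspan _ _); apply/funext => x; rewrite big_nil.
have [Pi|Pi] := boolP (P i).
  have := pspanD (hF i Pi) IH; congr (pspan _ _); apply/funext => x.
  by rewrite big_cons Pi.
by congr (pspan _ _): IH; apply/funext => x; rewrite big_cons (negbTE Pi).
Qed.

Lemma pspan_prod (s : seq 'I_(n * n)) (m : 'I_(n * n) -> nat) :
  pspan (\sum_(i <- s) m i) (fun x => \prod_(i <- s) mxvec (SO_mx x) 0 i ^+ m i).
Proof.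
elim: s => [|i s IH].
  rewrite big_nil; have := pspan_cst 1; congr (pspan _ _).
  by apply/funext => x; rewrite big_nil.
rewrite big_cons; have := pspan_coord_exp i (m i) IH; congr (pspan _ _).
by apply/funext => x; rewrite big_cons.
Qed.

Lemma pspan_poly k (p : mpoly.mpoly (n * n) R) : (msize p <= k.+1)%N ->
  pspan k (poly_eval p).
Proof.
move=> pk; pose mon (m : multinom (n * n)) (x : SO R n) :=
  mcoeff m p * \prod_i mxvec (SO_mx x) 0 i ^+ m i.
(* Repeating the support condition keeps membership available, and with it the degree bound of each
   monomial. *)
suff : pspan k (fun x => \sum_(m <- msupp p | m \in msupp p) mon m x).
  by congr (pspan _ _); apply/funext => x; rewrite -big_seq.
apply: pspan_sum => m mp; apply: pspanZ; apply: pspan_le (pspan_prod _ m).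
by rewrite -mdegE -ltnS; apply: leq_trans pk; exact: msize_mdeg_lt.
Qed.

End polynomial_representation.

(** * Quantitative bounds for polynomials *)

Section polynomial_bounds.
Context {R : realType}.

Lemma bmeas_poly_eval n (p : mpoly.mpoly (n * n) R) : bmeas (poly_eval p).
Proof.
have [c ->] : pspan (msize p) (poly_eval p) by exact/pspan_poly/leqnSn.
exact: (bmeas_dotv c (bmeas_orbit (rep_prep n (msize p)) (pvec _ _))).
Qed.

Lemma kac_poly_bound n (H : probability (SO R n) R) (hH : is_haar H) k T
    (x : SO R n) (p : mpoly.mpoly (n * n) R) :
  (1 < n)%N -> (0 < k)%N -> (msize p <= k.+1)%N ->
  (Ex (kac_law T x) (poly_eval p) - Ex H (poly_eval p)) ^+ 2 <=
  ((n * n + 1) ^ k)%:R * ((1 - (n%:R * k%:R)^-1) ^+ T *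
    Ex H (fun y => (poly_eval p y - Ex H (poly_eval p)) ^+ 2)).
Proof.
move=> n1 k0 pk; have [c pE] := pspan_poly pk.
rewrite -pdimE; apply: (kac_moment_bound (rep_prep n k) _ hH n1 T x pE).
by rewrite ler1n.
Qed.

(** With [L = ln n], the dimension is at most [exp (3 k L)] since [n^2 + 1 <= n^3], and the decay is
    at most [exp (- T / (n k)) <= exp (- 4 k L)]. The product is at most [exp (- k L) <= 1 / n]. *)
Lemma kac_rate_bound n k T : (1 < n)%N -> (0 < k)%N ->
  4 * (n%:R * k%:R * (k%:R + ln n%:R) * ln n%:R) <= T%:R :> R ->
  ((n * n + 1) ^ k)%:R * (1 - (n%:R * k%:R)^-1) ^+ T <= n%:R^-1 :> R.
Proof.
move=> n1 k0 hT.
have n0 : 0 < n%:R :> R by rewrite ltr0n ltnW.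
have k1 : 1 <= k%:R :> R by rewrite ler1n.
have k0R : 0 < k%:R :> R by rewrite ltr0n.
have nk0 : 0 < n%:R * k%:R :> R by rewrite mulr_gt0.
set L := ln n%:R : R.
have L0 : 0 <= L by rewrite ln_ge0// ler1n ltnW.
have Dle : ((n * n + 1) ^ k)%:R <= expR (3 * L * k%:R).
  rewrite mulrC expRM_natl natrX lerXn2r ?nnegrE ?expR_ge0//.
  rewrite expRM_natl lnK ?posrE// -natrX ler_nat.
  by case: n n1 {hT n0 nk0 L L0} => [|[|n]]// _; rewrite !expnS expn0; nia.
have qle : (1 - (n%:R * k%:R)^-1) ^+ T <= expR (- (4 * k%:R * L)) :> R.
  apply: le_trans (_ : expR (- (n%:R * k%:R)^-1) ^+ T <= _).
    rewrite lerXn2r ?nnegrE ?expR_ge0 ?expR_ge1Dx//.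
    by rewrite subr_ge0 invf_le1// -natrM ler1n muln_gt0 k0 ltnW.
  rewrite -expRM_natl ler_expR mulrN lerN2 -[leRHS]/(_ / _) ler_pdivlMr//.
  apply: le_trans hT; rewrite -/L -subr_ge0.
  have -> : 4 * (n%:R * k%:R * (k%:R + L) * L) - 4 * k%:R * L * (n%:R * k%:R) =
    4 * (n%:R * k%:R) * (L * L) by ring.
  by rewrite !mulr_ge0// ltW.
apply: le_trans (_ : expR (3 * L * k%:R) * expR (- (4 * k%:R * L)) <= _).
  rewrite ler_pM//; rewrite exprn_ge0// subr_ge0 invf_le1//.
  by rewrite -natrM ler1n muln_gt0 k0 ltnW.
rewrite -expRD -[in leRHS](lnK (x := n%:R)) ?posrE// -expRN ler_expR -/L.
nra.
Qed.

End polynomial_bounds.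

Theorem theorem2p7 (R : realType) (k T : nat -> nat)
  (hT : (fun n : nat => n%:R * (k n)%:R * ((k n)%:R + ln n%:R) * ln n%:R : R^o)
        =o_\oo (fun n : nat => (T n)%:R : R^o))
  (x : forall n : nat, SO R n)
  (H : forall n : nat, probability (SO R n) R)
  (hH : forall n : nat, is_haar (H n)) :
  weakly_indistinguishable_by_degree k (fun n => kac_law (T n) (x n)) H.
Proof.
move=> f fk [sdO gapN0]; apply: gapN0.
(* The little-o constant 1/4 matches the factor 4 in [kac_rate_bound]. *)
have /eqoP/(_ (1 / 4))/(_ (divr_gt0 ltr01 (ltr0n R 4))) hT' := hT.
move/eqO_exP : sdO => [C C0 sdO].
near=> n; have n1 : (1 < n)%N by near: n; exact: nbhs_infty_gt.
rewrite !ExE; [|exact: bmeas_poly_eval|exact: bmeas_poly_eval].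
set E1 := Ex (kac_law _ _) _; set E2 := Ex (H n) _.
pose V := Ex (H n) (fun y => (poly_eval (f n) y - E2) ^+ 2).
(* At degree 0 the polynomial is constant and the gap is 0; the rate [1 / (n k)] needs [k > 0]. *)
have [k0|k0] := posnP (k n).
  have [c fE] : pspan 0 (poly_eval (f n)).
    by apply: pspan_poly; rewrite -[X in (_ <= X.+1)%N]k0; exact: fk.
  rewrite /E1 /E2 fE /orbit /=; under eq_fun do rewrite mul1mx.
  by rewrite !Ex_cst subrr normr0.
have sd : Num.sqrt V <= C * `|E1 - E2|.
  apply: (@le_trans _ _ `|Num.sqrt (Num.max
      (fine (variance (kac_law (T n) (x n)) (poly_eval (f n))))
      (fine (variance (H n) (poly_eval (f n)))))|).
    rewrite ger0_norm ?sqrtr_ge0// ler_wsqrtr// le_max.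
    by rewrite (variance_Ex (H n) (bmeas_poly_eval (f n))) lexx orbT.
  rewrite -[`|E1 - E2|]normr_id /E1 /E2.
  rewrite -(ExE (H n) (bmeas_poly_eval _)) -(ExE (kac_law _ _) (bmeas_poly_eval _)).
  by near: n.
have V0 : 0 <= V by apply: Ex_ge0 => y; exact: sqr_ge0.
have VC : V <= C ^+ 2 * (E1 - E2) ^+ 2.
  rewrite -(sqr_sqrtr V0) -[(E1 - E2) ^+ 2]real_normK ?num_real// -exprMn.
  by rewrite lerXn2r ?nnegrE ?sqrtr_ge0 ?mulr_ge0 ?(ltW C0).
have T4 : 4 * (n%:R * (k n)%:R * ((k n)%:R + ln n%:R) * ln n%:R) <= (T n)%:R :> R.
  have : `|n%:R * (k n)%:R * ((k n)%:R + ln n%:R) * ln n%:R| <= 1 / 4 * `|(T n)%:R| :> R.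
    by near: n.
  rewrite normr_nat => /(le_trans (ler_norm _)).
  lra.
have gap := kac_poly_bound (hH n) (T n) (x n) n1 k0 (fk n).
rewrite -/E1 -/E2 -/V mulrA in gap.
have rate := kac_rate_bound n1 k0 T4.
have Cn : C ^+ 2 < n%:R by near: n; exact: nbhs_infty_gtr.
have n0 : 0 < n%:R :> R by rewrite ltr0n ltnW.
(* The squared gap is at most [V / n], hence at most [C ^+ 2 / n] times itself; as [n > C ^+ 2] it
   vanishes. *)
have le1 : (E1 - E2) ^+ 2 <= n%:R^-1 * (C ^+ 2 * (E1 - E2) ^+ 2).
  apply: le_trans gap _; apply: ler_pM => //.
  by rewrite mulr_ge0// exprn_ge0// subr_ge0 invf_le1// -natrM ?ltr0n ?ler1n muln_gt0 k0 ltnW.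
have : (E1 - E2) ^+ 2 <= 0.
  have : (n%:R - C ^+ 2) * (E1 - E2) ^+ 2 <= 0.
    by rewrite mulrBl subr_le0 -ler_pdivlMl.
  by rewrite pmulr_rle0// subr_gt0.
rewrite le_eqVlt ltNge sqr_ge0 orbF sqrf_eq0 => /eqP ->.
exact: normr0.
Unshelve. all: by end_near.
Qed.
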